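(* Let $p$ be a prime number larger than $2^{6}$ and let $(A,+,\circ)$ be a right nilpotent $\mathbb{F}_{p}$-brace of cardinality $p^{4}$ which is generated as a brace by one element. Then $A$ is the group of flows of a pre-Lie algebra over $\mathbb{F}_p$ of one of the types (I), (II), (III) defined in the context.
   Context: A left brace is a set $A$ with operations $+,\circ$ such that $(A,+)$ is an abelian group, $(A,\circ)$ is a group, and $a\circ(b+c)+a=a\circ b+a\circ c$ for all $a,b,c\in A$. One writes $a*b=a\circ b-a-b$. For a field $\mathbb{F}$, an $\mathbb{F}$-brace is a left brace whose additive group is an $\mathbb{F}$-vector space with $a*(\alpha b)=\alpha(a*b)$ for all $a,b\in A$, $\alpha\in\mathbb{F}$. $\mathbb{F}_p$ is the field with $p$ elements. Put $A^{(1)}=A$ and let $A^{(i+1)}$ be the set of all finite sums of elements $a*b$ with $a\in A^{(i)}$, $b\in A$; $A$ is right nilpotent if $A^{(n)}=0$ for some $n$. A brace is generated by $x$ if its smallest subbrace containing $x$ is the whole brace. A pre-Lie algebra over a field is a vector space with a bilinear operation $\cdot$ satisfying $(x\cdot y)\cdot z-x\cdot(y\cdot z)=(y\cdot x)\cdot z-y\cdot(x\cdot z)$ for all $x,y,z$. It is nilpotent of nilpotency index $n$ if all products of any $n$ elements (with any bracketing) are zero and $n$ is minimal with this property. For a pre-Lie algebra $A$, $A^{i}$ denotes the linear span of all products of $i$ or more elements, and $x^{2}=x\cdot x$. Group of flows: let $(A,+,\cdot)$ be a nilpotent pre-Lie algebra over $\mathbb{F}_p$ of nilpotency index $k<p$.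 For $a\in A$ let $L_a(b)=a\cdot b$ and $e^{L_a}(b)=b+a\cdot b+\frac1{2!}a\cdot(a\cdot b)+\frac1{3!}a\cdot(a\cdot(a\cdot b))+\cdots$, where the sum stops at place $k$ (all products of $k$ or more elements vanish). Let $W(a)=a+\frac1{2!}a\cdot a+\frac1{3!}a\cdot(a\cdot a)+\cdots$, again stopping at place $k$. The map $W:A\to A$ is bijective; let $\Omega$ be its inverse. Define $a\circ b=a+e^{L_{\Omega(a)}}(b)$. Then $(A,+,\circ)$, with the same addition, is a left brace, called the group of flows of $(A,+,\cdot)$. Types. In each case $A$ is a pre-Lie algebra over $\mathbb{F}_p$ of cardinality $p^4$ generated as a pre-Lie algebra by one element $x$. (I) $A^5\neq0$, $A^6=0$; $x,\ x^2,\ x^2\cdot x,\ w=x^2\cdot(x^2\cdot x)$ form a basis of $A$; all products of $5$ or more copies of $x$ are zero except $w\ne0$; $x^2\cdot x^2=(x^2\cdot x)\cdot x+x\cdot(x^2\cdot x)$; $(x\cdot x^2)\cdot x=x\cdot(x\cdot x^2)=0$; and for some $\alpha,\beta,\gamma\in\mathbb{F}_p$, $x\cdot x^2=\alpha w$, $(x^2\cdot x)\cdot x=\beta w$, $x\cdot(x^2\cdot x)=\gamma w$. (II) $A^4\neq0$, $A^5=0$; $x,\ x^2,\ a,\ b$ form a basis of $A$ for some $a\in\{x\cdot x^2,\ x^2\cdot x\}$ and some $0\neq b\in A^4$, and each $A^i$ is spanned by the basis elements lying in it; all products of $5$ or more elements are zero; $A^2/A^3$, $A^3/A^4$, $A^4$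 are one-dimensional; $(x^2\cdot x)\cdot x-(x\cdot x^2)\cdot x=x^2\cdot x^2-x\cdot(x^2\cdot x)$; and for some $\alpha,\beta\in\mathbb{F}_p$, not both zero, $\alpha(x\cdot x^2)+\beta(x^2\cdot x)\in A^4$, so that $\alpha\,x\cdot(x\cdot x^2)+\beta\,x\cdot(x^2\cdot x)=0$ and $\alpha\,(x\cdot x^2)\cdot x+\beta\,(x^2\cdot x)\cdot x=0$. (III) $A^4=0$; $x,\ x^2,\ x^2\cdot x,\ x\cdot x^2$ form a basis of $A$; all products of more than $3$ elements are zero and there are no other relations. *)

(* Defs.v *)
From HB Require Import structures.
From mathcomp Require Import all_boot all_order all_algebra all_field.
From mathcomp Require Import boolp.

Set Implicit Arguments.
Unset Strict Implicit.
Unset Printing Implicit Defensive.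

Import GRing.Theory.
Local Open Scope ring_scope.

Record left_brace (A : zmodType) := LeftBrace {
  circ :> A -> A -> A;
  circ1 : A;
  circV : A -> A;
  circA : associative circ;
  circ1l : left_id circ1 circ;
  circ1r : right_id circ1 circ;
  circVl : left_inverse circ1 circV circ;
  circVr : right_inverse circ1 circV circ;
  circDr : forall a b c : A, circ a (b + c) + a = circ a b + circ a c }.

Definition star (A : zmodType) (B : left_brace A) (a b : A) : A := B a b - a - b.

Definition is_F_brace (F : fieldType) (A : lmodType F) (B : left_brace A) : Prop :=
  forall (a b : A) (alpha : F), star B a (alpha *: b) = alpha *: star B a b.

(* [right_series B n] is A^(n+1). *)
Fixpoint right_series (A : zmodType) (B : left_brace A) (n : nat) : A -> Prop :=
  if n is m.+1 then
    fun v => exists s : seq (A * A),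
      (forall u, u \in s -> right_series B m u.1)
      /\ v = \sum_(u <- s) star B u.1 u.2
  else fun _ => True.

Definition right_nilpotent (A : zmodType) (B : left_brace A) : Prop :=
  exists n : nat, forall v : A, right_series B n v <-> v = 0.

Record is_subbrace (A : zmodType) (B : left_brace A) (S : A -> Prop) : Prop := {
  subbrace0 : S 0;
  subbraceB : forall a b, S a -> S b -> S (a - b);
  subbrace1 : S (circ1 B);
  subbraceM : forall a b, S a -> S b -> S (B a b);
  subbraceV : forall a, S a -> S (circV B a) }.

Definition brace_generated (A : zmodType) (B : left_brace A) (x : A) : Prop :=
  forall S : A -> Prop, is_subbrace B S -> S x -> forall a, S a.

(* Bracketed words, the formal nonassociative products with letters in T. *)
Inductive bracketing (T : Type) : Type :=
  | Letter of T
  | Prod of bracketing T & bracketing T.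

Fixpoint nletters (T : Type) (t : bracketing T) : nat :=
  if t is Prod l r then (nletters l + nletters r)%N else 1.

Fixpoint evalb (T A : Type) (mul : A -> A -> A) (f : T -> A) (t : bracketing T) : A :=
  match t with
  | Letter a => f a
  | Prod l r => mul (evalb mul f l) (evalb mul f r)
  end.

Definition product_of (A : Type) (mul : A -> A -> A) (n : nat) (v : A) : Prop :=
  exists t : bracketing A, nletters t = n /\ v = evalb mul id t.

Definition products_vanish (A : zmodType) (mul : A -> A -> A) (n : nat) : Prop :=
  forall v, product_of mul n v -> v = 0.

(* Every bracketing has a letter, so [products_vanish mul 0] holds vacuously:
   the index is the least positive n. *)
Definition nilpotency_index (A : zmodType) (mul : A -> A -> A) (n : nat) : Prop :=
  [/\ (0 < n)%N, products_vanish mul n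
    & forall m, (0 < m < n)%N -> ~ products_vanish mul m].

Record is_pre_lie (F : fieldType) (A : lmodType F) (mul : A -> A -> A) : Prop := {
  pre_lie_linearr : forall a, linear (mul a);
  pre_lie_linearl : forall b, linear (mul^~ b);
  pre_lie_law : forall x y z,
    mul (mul x y) z - mul x (mul y z) = mul (mul y x) z - mul y (mul x z) }.

Definition pre_lie_generated (F : fieldType) (A : vectType F) (mul : A -> A -> A)
    (x : A) : Prop :=
  forall U : {vspace A},
    (forall u v, u \in U -> v \in U -> mul u v \in U) -> x \in U -> U = fullv.

(* [finvect_type A] is A itself, as a finite type. *)
Definition algpow (F : finFieldType) (A : vectType F) (mul : A -> A -> A)
    (i : nat) : {vspace A} :=
  <<[seq v : A <- enum (finvect_type A)
      | `[< exists2 n, (i <= n)%N & product_of mul n v >]]>>%VS.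

(* For k the nilpotency index, the term of index k and the following ones in both
   series are products of k or more elements, hence zero. *)
Section Flows.

Variables (F : fieldType) (A : lmodType F) (mul : A -> A -> A) (k : nat).

Definition expL (a b : A) : A :=
  \sum_(0 <= i < k) (i`!%:R : F)^-1 *: iter i (mul a) b.

Definition flowW (a : A) : A :=
  \sum_(1 <= i < k.+1) (i`!%:R : F)^-1 *: iter i.-1 (mul a) a.

End Flows.

Definition is_group_of_flows (p : nat) (A : lmodType 'F_p) (mul : A -> A -> A)
    (B : left_brace A) : Prop :=
  exists2 k : nat, nilpotency_index mul k /\ (k < p)%N
  & exists Omega : A -> A,
      [/\ cancel (flowW mul k) Omega, cancel Omega (flowW mul k)
        & forall a b, B a b = a + expL mul k (Omega a) b].

Section Types.

Variables (F : finFieldType) (A : vectType F) (mul : A -> A -> A) (x : A).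

Local Notation "a · b" := (mul a b) (at level 40, left associativity).
Local Notation "A^^ i" := (algpow mul i) (at level 8, i at level 2, format "A^^ i").
Local Notation x2 := (x · x).

Definition evalx (t : bracketing unit) : A := evalb mul (fun=> x) t.

(* The bracketing (xx)((xx)x) of w. *)
Definition wbracketing : bracketing unit :=
  let X := Letter tt in Prod (Prod X X) (Prod (Prod X X) X).

Definition type_I : Prop :=
  let w := x2 · (x2 · x) in
  [/\ A^^5 != 0%VS /\ A^^6 = 0%VS,
      basis_of fullv [:: x; x2; x2 · x; w],
      (forall t, (5 <= nletters t)%N -> t <> wbracketing -> evalx t = 0) /\ w != 0,
      [/\ x2 · x2 = (x2 · x) · x + x · (x2 · x),
          (x · x2) · x = 0 & x · (x · x2) = 0]
    & exists alpha beta gamma : F,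
        [/\ x · x2 = alpha *: w, (x2 · x) · x = beta *: w
          & x · (x2 · x) = gamma *: w]].

(* [U :\: V] is a complement of V in U, so that its dimension is that of U / V. *)
Definition type_II : Prop :=
  [/\ A^^4 != 0%VS /\ A^^5 = 0%VS,
      (exists a b : A,
        [/\ a = x · x2 \/ a = x2 · x,
            b != 0 /\ b \in A^^4,
            basis_of fullv [:: x; x2; a; b]
          & forall i, A^^i = <<[seq e <- [:: x; x2; a; b] | e \in A^^i]>>%VS]),
      (forall n, (5 <= n)%N -> products_vanish mul n)
      /\ [/\ \dim (A^^2 :\: A^^3) = 1, \dim (A^^3 :\: A^^4) = 1 & \dim A^^4 = 1]%N,
      (x2 · x) · x - (x · x2) · x = x2 · x2 - x · (x2 · x)
    & exists alpha beta : F,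
        [/\ (alpha, beta) <> (0, 0),
            alpha *: (x · x2) + beta *: (x2 · x) \in A^^4,
            alpha *: (x · (x · x2)) + beta *: (x · (x2 · x)) = 0
          & alpha *: ((x · x2) · x) + beta *: ((x2 · x) · x) = 0]].

(* Every linear relation between the bracketings of copies of x is a consequence
   of the pre-Lie identity and of the vanishing of the products of more than 3
   elements: it holds for any element of any pre-Lie algebra with that property. *)
Definition no_other_relations : Prop :=
  forall r : seq (F * bracketing unit),
    \sum_(c <- r) c.1 *: evalx c.2 = 0 ->
    forall (C : lmodType F) (m : C -> C -> C) (y : C),
      is_pre_lie m -> (forall n, (3 < n)%N -> products_vanish m n) ->
      \sum_(c <- r) c.1 *: evalb m (fun=> y) c.2 = 0.

Definition type_III : Prop :=
  [/\ A^^4 = 0%VS,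
      basis_of fullv [:: x; x2; x2 · x; x · x2],
      (forall n, (3 < n)%N -> products_vanish mul n)
    & no_other_relations].

End Types.

(* Main.v *)
From HB Require Import structures.
Require Import Defs.
From mathcomp Require Import all_boot all_order all_algebra all_fingroup.
From mathcomp Require Import all_solvable all_field all_character.
From mathcomp Require Import boolp ring zify.

(** Write lam_a(b) = a o b - a. The affine maps b |-> a + lam_a(b) form a group G of
    order p^d, where d is the dimension of A, and G acts simply transitively on A. As a
    p-group in characteristic p, it preserves a flag and acts trivially on its quotients
    (pgroup_flag). Since p is large compared with d, the truncated exponential is a
    bijection from the nilpotent matrices that respect the flag to the unipotent ones.

    The heart of the proof is that the logarithms of G form a Lie algebra over F_p. This
    is a case of the Lazard correspondence, proved here without the
    Baker-Campbell-Hausdorff formula: a family h(t) in G, polynomial in t with t in F_p,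
    that starts with 1 + tV can be corrected by products of dilated powers of itself
    until it is exp(tV) (tangent_texp_in). Sums and brackets of logarithms are tangent
    vectors of such families (liealgD, liealg_bracket).

    An element of this Lie algebra has a translation part v and a linear part L_v. Simple
    transitivity makes v a coordinate on the Lie algebra, and v . w = L_v(w) is a pre-Lie
    product, as closure under brackets says that [L_v, L_w] = L_(v . w - w . v).
    Exponentiating back, G consists of the maps b |-> W(v) + exp(L_v)(b), so A is the
    group of flows of this product (brace_flows).

    The flag makes the left multiplications jointly nilpotent. Taking derivatives of
    W(t r) * b at t = 0 shows that the right powers of the pre-Lie algebra are contained
    in the right series of the brace, so right nilpotency carries over, and left and
    right nilpotency together give nilpotency (products_vanish_big). A pre-Lie subalgebra
    is a subbrace, so a generator x of the brace generates the pre-Lie algebra.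

    It remains to classify the nilpotent pre-Lie algebras of dimension 4 with one
    generator x, by means of the powers P i, the spans of the products of at least i
    elements. P 1, P 2, P 3 have the dimensions 4, 3, 2, and P 3 is spanned modulo P 4
    by x x^2 and x^2 x. If P 4 = 0 the algebra has type III; if P 4 is nonzero, it is a
    line, and the type is II if P 5 = 0. Otherwise P 4 = P 5; a power may equal the next
    nonzero one, because a product of an element of P 2 with one of P 3 need not have a
    factor in P 4. Repeated use of the pre-Lie identity shows that P 6 = 0, that
    x x^2 lies in P 5, and that P 5 is spanned by x^2 (x^2 x): this is type I. *)

Set Implicit Arguments.
Unset Strict Implicit.
Unset Printing Implicit Defensive.

Import GRing.Theory VectorInternalTheory.
Local Open Scope ring_scope.

(** * Linear combinations *)

Inductive lexpr (K : Type) : Type :=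
  | LVar of nat
  | LZero
  | LAdd of lexpr K & lexpr K
  | LOpp of lexpr K
  | LScale of K & lexpr K.

Arguments LVar {K}.
Arguments LZero {K}.

Section LinearExpressions.

Variables (K : pzRingType) (V : lmodType K).

Fixpoint leval (env : seq V) (e : lexpr K) : V :=
  match e with
  | LVar i => env`_i
  | LZero => 0
  | LAdd e1 e2 => leval env e1 + leval env e2
  | LOpp e1 => - leval env e1
  | LScale c e1 => c *: leval env e1
  end.

Fixpoint lcoef (e : lexpr K) (i : nat) : K :=
  match e with
  | LVar j => if j == i then 1 else 0
  | LZero => 0
  | LAdd e1 e2 => lcoef e1 i + lcoef e2 i
  | LOpp e1 => - lcoef e1 i
  | LScale c e1 => c * lcoef e1 i
  end.

Lemma leval_lcoef env e : leval env e = \sum_(i < size env) lcoef e i *: env`_i.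
Proof.
elim: e => /= [j||e1 -> e2 ->|e1 ->|c e1 ->].
- case: (ltnP j (size env)) => [ltj|lej].
    rewrite (bigD1 (Ordinal ltj)) //= eqxx scale1r big1 ?addr0 // => i neij.
    by rewrite eq_sym (negPf (_ : i != j :> nat)) ?scale0r.
  rewrite nth_default // big1 // => i _.
  by rewrite gtn_eqF ?scale0r // (leq_trans (ltn_ord i)).
- by rewrite big1 // => i _; rewrite scale0r.
- by rewrite -big_split; apply: eq_bigr => i _; rewrite scalerDl.
- by rewrite -sumrN; apply: eq_bigr => i _; rewrite scaleNr.
- by rewrite scaler_sumr; apply: eq_bigr => i _; rewrite scalerA.
Qed.

Fixpoint lcoef_eq (e1 e2 : lexpr K) (n : nat) : Prop :=
  if n is m.+1 then lcoef e1 m = lcoef e2 m /\ lcoef_eq e1 e2 m else True.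

Lemma leval_eq env e1 e2 :
  lcoef_eq e1 e2 (size env) -> leval env e1 = leval env e2.
Proof.
move=> eq12; rewrite !leval_lcoef; apply: eq_bigr => -[i /= lti] _; congr (_ *: _).
elim: (size env) lti eq12 => //= m IHm; rewrite ltnS leq_eqVlt.
by case/predU1P => [-> []|ltim [_ /IHm]] //; apply.
Qed.

End LinearExpressions.

(* Atoms are compared up to unification, since an element such as 1 may come with
   different but convertible structures. *)
Ltac lmod_index x env :=
  lazymatch env with
  | cons ?y ?env' =>
    match constr:(Set) with
    | _ => let _ := match constr:(Set) with _ => unify x y end in constr:(O)
    | _ => let i := lmod_index x env' in constr:(S i)
    end
  end.

Ltac lmod_mem x env :=
  lazymatch env with
  | cons ?y ?env' =>
    match constr:(Set) with
    | _ => let _ := match constr:(Set) with _ => unify x y end in constr:(true)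
    | _ => lmod_mem x env'
    end
  | _ => constr:(false)
  end.

Ltac lmod_atoms t env :=
  lazymatch t with
  | (?x + ?y)%R => let env1 := lmod_atoms x env in lmod_atoms y env1
  | (- ?x)%R => lmod_atoms x env
  | (_ *: ?x)%R => lmod_atoms x env
  | 0%R => env
  | _ => lazymatch lmod_mem t env with
         | true => env
         | false => constr:(cons t env)
         end
  end.

Ltac lmod_reify K t env :=
  lazymatch t with
  | (?x + ?y)%R => let a := lmod_reify K x env in let b := lmod_reify K y env in
                   constr:(@LAdd K a b)
  | (- ?x)%R => let a := lmod_reify K x env in constr:(@LOpp K a)
  | (?c *: ?x)%R => let a := lmod_reify K x env in constr:(@LScale K c a)
  | 0%R => constr:(@LZero K)
  | _ => let i := lmod_index t env in constr:(@LVar K i)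
  end.

(** Proves equalities between linear combinations in a module over the commutative
    ring K, by comparing coefficients. *)
Ltac lmod_eq K :=
  lazymatch goal with
  | |- @eq ?V ?a ?b =>
    let env0 := lmod_atoms a (@nil V) in
    let env := lmod_atoms b env0 in
    let e1 := lmod_reify K a env in
    let e2 := lmod_reify K b env in
    refine (@leval_eq _ _ env e1 e2 _);
    rewrite /lcoef_eq /=; repeat split; try ring
  end.

(** * The Lie algebra of a unipotent group over F_p *)

Lemma natf_neq0_Fp (p m : nat) : prime p -> (0 < m < p)%N -> m%:R != 0 :> 'F_p.
Proof.
move=> p_pr /andP[m_gt0 m_ltp].
by rewrite -(dvdn_pcharf (pchar_Fp p_pr)) gtnNdvd.
Qed.

Lemma fact_neq0_Fp (p i : nat) : prime p -> (i < p)%N -> i`!%:R != 0 :> 'F_p.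
Proof.
move=> p_pr; elim: i => [|i IHi] ltip; first by rewrite oner_eq0.
by rewrite factS natrM mulf_neq0 ?IHi ?natf_neq0_Fp // ltnW.
Qed.

Lemma exp2_neq_Fp (p n i j : nat) : prime p -> (2 ^ n <= p)%N -> (i < j <= n)%N ->
  2 ^+ i != 2 ^+ j :> 'F_p.
Proof.
move=> p_pr le2np /andP[ltij lejn]; rewrite eq_sym -subr_eq0 -!natrX -natrB.
  rewrite natf_neq0_Fp // subn_gt0 ltn_exp2l // ltij /=.
  apply: leq_trans le2np; apply: leq_trans (_ : 2 ^ j <= _)%N; last by rewrite leq_exp2l.
  by rewrite ltn_subrL !expn_gt0.
by rewrite leq_exp2l // ltnW.
Qed.

(** Elements of N i have weight i: in the application the linear maps that move a flag
    down by i steps. A product of n elements of weight 1 vanishes. *)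
Record filtration (F : fieldType) (R : algType F) (n : nat) (N : nat -> R -> Prop) :
    Prop := Filtration {
  filt0 : forall i, N i 0;
  filtD : forall i X Y, N i X -> N i Y -> N i (X + Y);
  filtZ : forall i c X, N i X -> N i (c *: X);
  filt1 : N 0 1;
  filtM : forall i j X Y, N i X -> N j Y -> N (i + j)%N (X * Y);
  filtS : forall i X, N i.+1 X -> N i X;
  filt_vanish : forall X, N n X -> X = 0 }.

Section Lazard.

Variables (p : nat) (R : algType 'F_p) (n : nat) (N : nat -> R -> Prop).
Hypotheses (p_pr : prime p) (n_gt1 : (1 < n)%N) (n_small : (2 ^ n <= p)%N).
Hypothesis filtN : filtration n N.

Local Notation F := 'F_p.

Let n_ltp : (n < p)%N. Proof. exact: leq_trans (ltn_expl n _) n_small. Qed.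

Lemma filtB i X Y : N i X -> N i Y -> N i (X - Y).
Proof. by move=> NX NY; apply: (filtD filtN) => //; rewrite -scaleN1r; apply: (filtZ filtN). Qed.

Lemma filt_le i j X : (i <= j)%N -> N j X -> N i X.
Proof.
move=> leij; rewrite -(subnK leij); elim: (j - i)%N => // k IHk /(filtS filtN).
exact: IHk.
Qed.

Lemma filt_sum (I : Type) (r : seq I) (P : pred I) i (f : I -> R) :
  (forall k, P k -> N i (f k)) -> N i (\sum_(k <- r | P k) f k).
Proof.
move=> Nf; elim/big_ind: _ => //; first exact: filt0 filtN i.
exact: filtD filtN i.
Qed.

Lemma filtX X k : N 1 X -> N k (X ^+ k).
Proof.
move=> NX; elim: k => [|k IHk]; first by rewrite expr0; apply: filt1 filtN.
by rewrite exprS -add1n; apply: (filtM filtN).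
Qed.

Lemma filt_eq0 i X : (n <= i)%N -> N i X -> X = 0.
Proof. by move=> leni /(filt_le leni)/(filt_vanish filtN). Qed.

Definition texp (X : R) : R := \sum_(0 <= i < n) (i`!%:R : F)^-1 *: X ^+ i.

Lemma texpE X : texp X = 1 + X + \sum_(2 <= i < n) (i`!%:R : F)^-1 *: X ^+ i.
Proof.
rewrite /texp big_ltn ?(ltnW n_gt1) // big_ltn // addrA.
by rewrite !invr1 !scale1r expr0 expr1.
Qed.

Lemma texp0 : texp 0 = 1.
Proof.
rewrite texpE addr0 big_nat_cond big1 ?addr0 // => -[|[|i]] // _.
by rewrite expr0n scaler0.
Qed.

Lemma horner_alg_nilp X (q : {poly F}) : N 1 X ->
  horner_alg X q = \sum_(0 <= i < n) q`_i *: X ^+ i.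
Proof.
move=> NX; rewrite /horner_alg /horner_morph.
have size_q : (size (map_poly (in_alg R) q) <= maxn n (size q))%N.
  by rewrite size_map_poly leq_maxr.
rewrite (horner_coef_wide _ size_q) (big_mkord xpredT (fun i => q`_i *: X ^+ i)).
rewrite (big_ord_widen _ (fun i => q`_i *: X ^+ i) (leq_maxl n (size q))) [RHS]big_mkcond.
apply: eq_bigr => i _; rewrite coef_map /= mulr_algl; case: ltnP => // leni.
by rewrite (filt_eq0 leni (filtX i NX)) scaler0.
Qed.

(** Below order n the coefficients are those of the product of two exponential series,
    by the binomial formula; the powers of X of order n and above vanish. *)
Lemma texp_add X (a b : F) : N 1 X ->
  texp (a *: X) * texp (b *: X) = texp ((a + b) *: X).
Proof.
move=> NX; pose e (c : F) : {poly F} := \poly_(i < n) (c ^+ i / i`!%:R).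
have texp_e c : texp (c *: X) = horner_alg X (e c).
  rewrite horner_alg_nilp //; apply: eq_big_nat => i /andP[_ ltin].
  by rewrite coef_poly ltin exprZn scalerA mulrC.
rewrite !texp_e; transitivity (horner_alg X (e a * e b)); first by rewrite rmorphM.
rewrite !horner_alg_nilp //.
apply: eq_big_nat => k /andP[_ ltkn]; congr (_ *: _).
rewrite coefM coef_poly ltkn addrC exprDn mulr_suml; apply: eq_bigr => i _.
have leik : (i <= k)%N by rewrite -ltnS.
rewrite !coef_poly (leq_ltn_trans leik) // (leq_ltn_trans (leq_subr _ _)) //.
rewrite -(bin_fact leik) -[_ *+ 'C(k, i)]mulr_natr !natrM.
have ltkp := ltn_trans ltkn n_ltp.
have C0 : 'C(k, i)%:R != 0 :> F.
  move: (fact_neq0_Fp p_pr ltkp).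
  by rewrite -(bin_fact leik) natrM mulf_eq0 negb_or => /andP[].
by rewrite mulrACA [in RHS]invfM [RHS]mulrA mulfK // [in RHS]invfM [in RHS](mulrC (b ^+ _)).
Qed.

Lemma texp_natmul X (k : nat) : N 1 X -> texp (k%:R *: X) = texp X ^+ k.
Proof.
move=> NX; elim: k => [|k IHk]; first by rewrite scale0r texp0.
by rewrite -natr1 -texp_add // IHk scale1r exprSr.
Qed.

Lemma filt_expB X Y m k : N 1 X -> N 1 Y -> N m (X - Y) ->
  N (m + k)%N (X ^+ k.+1 - Y ^+ k.+1).
Proof.
move=> NX NY NXY; elim: k => [|k IHk]; first by rewrite addn0.
have -> : X ^+ k.+2 - Y ^+ k.+2
        = X ^+ k.+1 * (X - Y) + (X ^+ k.+1 - Y ^+ k.+1) * Y.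
  by rewrite mulrBr mulrBl -!exprSr addrA subrK.
apply: (filtD filtN); last by rewrite addnS -addn1; apply: (filtM filtN).
by rewrite addnC; apply: (filtM filtN) => //; apply: filtX.
Qed.

(** Modulo higher weight, exp is a translation. This makes it injective on N 1, and
    surjective onto 1 + N 1 by successive approximation. *)
Lemma texp_linear_part X Y m : N 1 X -> N 1 Y -> N m (X - Y) ->
  N m.+1 (texp X - texp Y - (X - Y)).
Proof.
move=> NX NY NXY; rewrite !texpE.
have tails (s t : R) : 1 + X + s - (1 + Y + t) - (X - Y) = s - t.
  by lmod_eq 'F_p.
rewrite tails -sumrB big_nat_cond; apply: filt_sum => -[|[|i]] // _.
rewrite -scalerBr; apply: (filtZ filtN).
by apply: filt_le (filt_expB i.+1 NX NY NXY); rewrite addnS ltnS leq_addr.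
Qed.

Lemma texp_inj X Y : N 1 X -> N 1 Y -> texp X = texp Y -> X = Y.
Proof.
move=> NX NY eqE; apply/eqP; rewrite -subr_eq0; apply/eqP.
apply: (@filt_eq0 n) => //; elim: (n) => [|[|m] IHm].
- exact/(filtS filtN)/filtB.
- exact: filtB.
have := texp_linear_part NX NY IHm; rewrite eqE subrr sub0r -scaleN1r.
by move=> /(filtZ filtN (-1)); rewrite scalerA mulrNN mulr1 scale1r.
Qed.

Lemma texp_surj g : N 1 (g - 1) -> exists2 X, N 1 X & texp X = g.
Proof.
move=> Ng; suff [X NX Ngn] : exists2 X, N 1 X & N n (g - texp X).
  exists X => //; apply/esym/eqP; rewrite -subr_eq0; apply/eqP.
  exact: (filt_vanish filtN).
elim: (n) => [|[|m] [X NX IHm]].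
- exists 0; first exact: filt0 filtN _.
  by rewrite texp0; apply: filtS filtN _ _ Ng.
- by exists 0; [exact: filt0 filtN _ | rewrite texp0].
have NX' : N 1 (X + (g - texp X)).
  by apply: (filtD filtN) => //; apply: filt_le IHm.
exists (X + (g - texp X)) => //.
have := @texp_linear_part (X + (g - texp X)) X m.+1 NX' NX.
rewrite [X + _]addrC addrK => /(_ IHm) /(filtZ filtN (-1)).
by rewrite scaleN1r !opprB addrC addrA subrK addrC.
Qed.

(** The families t |-> \sum_(i >= m) t^i c_i with c_i in N_i, for t in F_p.
    They stand for the terms of order m and above of the power series in t below,
    and the weight of the coefficients makes them polynomials of degree < n. *)
Inductive bigO (m : nat) : (F -> R) -> Prop :=
  | bigO_monomial i X : (m <= i)%N -> N i X -> bigO m (fun t => t ^+ i *: X)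
  | bigO_add f g : bigO m f -> bigO m g -> bigO m (fun t => f t + g t)
  | bigO_ext f g : f =1 g -> bigO m f -> bigO m g.

Lemma bigO_le l m f : (l <= m)%N -> bigO m f -> bigO l f.
Proof.
move=> lelm; elim=> [i X lemi NX|f1 f2 _ O1 _ O2|f1 f2 eqf _ O1].
- exact: bigO_monomial (leq_trans lelm lemi) NX.
- exact: bigO_add.
- exact: bigO_ext eqf O1.
Qed.

Lemma bigO_const m X : N m X -> bigO 0 (fun=> X).
Proof.
move=> NX; apply: (bigO_ext (f := fun t => t ^+ 0 *: X)).
  by move=> t; rewrite expr0 scale1r.
by apply: bigO_monomial => //; apply: filt_le NX.
Qed.

Lemma bigO0 m : bigO m (fun=> 0).
Proof.
apply: (bigO_ext (f := fun t => t ^+ m *: 0)); first by move=> t; rewrite scaler0.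
by apply: bigO_monomial => //; apply: filt0 filtN _.
Qed.

Lemma bigO_scale m c f : bigO m f -> bigO m (fun t => c *: f t).
Proof.
elim=> [i X lemi NX|f1 f2 _ O1 _ O2|f1 f2 eqf _ O1].
- apply: (bigO_ext (f := fun t => t ^+ i *: (c *: X))).
    by move=> t; rewrite !scalerA mulrC.
  by apply: bigO_monomial => //; apply: (filtZ filtN).
- by apply: bigO_ext (bigO_add O1 O2) => t; rewrite scalerDr.
- by apply: bigO_ext O1 => t; rewrite eqf.
Qed.

Lemma bigO_sub m f g : bigO m f -> bigO m g -> bigO m (fun t => f t - g t).
Proof.
move=> Of /(bigO_scale (-1)) Og; apply: bigO_ext (bigO_add Of Og) => t.
by rewrite scaleN1r.
Qed.

Lemma bigO_dilate m s f : bigO m f -> bigO m (fun t => f (s * t)).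
Proof.
elim=> [i X lemi NX|f1 f2 _ O1 _ O2|f1 f2 eqf _ O1].
- apply: (bigO_ext (f := fun t => t ^+ i *: (s ^+ i *: X))).
    by move=> t; rewrite scalerA mulrC exprMn.
  by apply: bigO_monomial => //; apply: (filtZ filtN).
- exact: bigO_add O1 O2.
- by apply: bigO_ext O1 => t; rewrite eqf.
Qed.

Lemma bigO_mul l m f g : bigO l f -> bigO m g -> bigO (l + m) (fun t => f t * g t).
Proof.
move=> Of Og; elim: Of => [i X leli NX|f1 f2 _ O1 _ O2|f1 f2 eqf _ O1]; first last.
- by apply: bigO_ext O1 => t; rewrite eqf.
- by apply: bigO_ext (bigO_add O1 O2) => t; rewrite mulrDl.
elim: Og => [j Y lemj NY|g1 g2 _ O1 _ O2|g1 g2 eqg _ O1]; first last.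
- by apply: bigO_ext O1 => t; rewrite eqg.
- by apply: bigO_ext (bigO_add O1 O2) => t; rewrite mulrDr.
apply: (bigO_ext (f := fun t => t ^+ (i + j) *: (X * Y))).
  by move=> t; rewrite -scalerAl -scalerAr scalerA exprD.
by apply: bigO_monomial; [exact: leq_add | apply: (filtM filtN)].
Qed.

Lemma bigO_vanish f t : bigO n f -> f t = 0.
Proof.
elim=> [i X leni NX|f1 f2 _ f1_0 _ f2_0|f1 f2 eqf _ f1_0].
- by rewrite (filt_eq0 leni NX) scaler0.
- by rewrite f1_0 f2_0 addr0.
- by rewrite -eqf.
Qed.

Lemma bigO_lead m f : bigO m f ->
  exists2 Z, N m Z & bigO m.+1 (fun t => f t - t ^+ m *: Z).
Proof.
elim=> [i X lemi NX|f1 f2 _ [Z1 N1 O1] _ [Z2 N2 O2]|f1 f2 eqf _ [Z1 N1 O1]].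
- have [eqmi|nemi] := eqVneq m i.
    exists X; rewrite ?eqmi //; apply: bigO_ext (bigO0 _) => t.
    by rewrite subrr.
  exists 0; first exact: filt0 filtN _.
  apply: (bigO_ext (f := fun t => t ^+ i *: X)).
    by move=> t; rewrite scaler0 subr0.
  by apply: bigO_monomial => //; rewrite ltn_neqAle nemi.
- exists (Z1 + Z2); first exact: (filtD filtN).
  by apply: bigO_ext (bigO_add O1 O2) => t; rewrite scalerDr opprD addrACA.
- by exists Z1 => //; apply: bigO_ext O1 => t; rewrite eqf.
Qed.

Lemma bigO_sum (I : Type) (r : seq I) (P : pred I) m (f : I -> F -> R) :
  (forall i, P i -> bigO m (f i)) -> bigO m (fun t => \sum_(i <- r | P i) f i t).
Proof.
move=> Of; elim: r => [|i r IHr].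
  by apply: bigO_ext (bigO0 _) => t; rewrite big_nil.
case Pi: (P i).
  by apply: bigO_ext (bigO_add (Of i Pi) IHr) => t; rewrite big_cons Pi.
by apply: bigO_ext IHr => t; rewrite big_cons Pi.
Qed.

Lemma bigO_texp2 X : N 1 X -> bigO 2 (fun t => texp (t *: X) - 1 - t *: X).
Proof.
move=> NX; apply: (bigO_ext
    (f := fun t => \sum_(2 <= i < n) t ^+ i *: ((i`!%:R : F)^-1 *: X ^+ i))).
  move=> t; transitivity (\sum_(2 <= i < n) (i`!%:R : F)^-1 *: (t *: X) ^+ i).
    by apply: eq_bigr => i _; rewrite exprZn !scalerA mulrC.
  by rewrite texpE; lmod_eq 'F_p.
apply: (bigO_ext (f := fun t =>
    \sum_(2 <= i < n | (1 < i)%N) t ^+ i *: ((i`!%:R : F)^-1 *: X ^+ i))).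
  by move=> t; rewrite big_nat_cond [RHS]big_nat_cond; apply: eq_bigl => i; case: (1 < i)%N.
apply: bigO_sum => i i_gt1; apply: bigO_monomial => //.
by apply: (filtZ filtN); apply: filtX.
Qed.

Lemma bigO_linear X : N 1 X -> bigO 1 (fun t => t *: X).
Proof.
move=> NX; apply: (bigO_ext (f := fun t => t ^+ 1 *: X)) => //.
exact: bigO_monomial.
Qed.

Lemma bigO_texp1 X : N 1 X -> bigO 1 (fun t => texp (t *: X) - 1).
Proof.
move=> NX; have O2 := bigO_le (isT : (1 <= 2)%N) (bigO_texp2 NX).
by apply: bigO_ext (bigO_add O2 (bigO_linear NX)) => t; rewrite subrK.
Qed.

(** Modulo terms of order above m, perturbations of order m of two families that
    start with 1 add up when the families are multiplied. *)
Lemma bigO_mul_perturb m a b a0 b0 z w : (0 < m)%N ->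
  bigO 1 (fun t => a0 t - 1) -> bigO 1 (fun t => b0 t - 1) ->
  bigO m z -> bigO m w ->
  bigO m.+1 (fun t => a t - a0 t - z t) -> bigO m.+1 (fun t => b t - b0 t - w t) ->
  bigO m.+1 (fun t => a t * b t - a0 t * b0 t - (z t + w t)).
Proof.
move=> m_gt0 Oa0 Ob0 Oz Ow Oa Ob; have O1 := bigO_const (filt1 filtN).
have Ob1 : bigO 1 (fun t => b t - 1).
  have O' := bigO_add (bigO_le (ltn0Sn m) Ob) (bigO_le m_gt0 Ow).
  by apply: bigO_ext (bigO_add O' Ob0) => t; rewrite subrK addrA subrK.
have Ob' : bigO 0 b.
  by apply: bigO_ext (bigO_add (bigO_le (leq0n 1) Ob1) O1) => t; rewrite subrK.
have Oa0' : bigO 0 a0.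
  by apply: bigO_ext (bigO_add (bigO_le (leq0n 1) Oa0) O1) => t; rewrite subrK.
have T1 := bigO_mul Oa Ob'; have T2 := bigO_mul Oa0' Ob.
have T3 := bigO_mul Oz Ob1; have T4 := bigO_mul Oa0 Ow.
rewrite addn0 add0n addn1 add1n in T1 T2 T3 T4.
apply: bigO_ext (bigO_add (bigO_add T1 T2) (bigO_add T3 T4)) => t.
rewrite !mulrBl !mulrBr mulr1 mul1r.
by lmod_eq 'F_p.
Qed.

Section Subgroup.

Variable G : R -> Prop.
Hypotheses (G1 : G 1) (GM : forall g h, G g -> G h -> G (g * h)).

Lemma subgroupX g k : G g -> G (g ^+ k).
Proof. by move=> Gg; elim: k => [|k IHk]; rewrite ?expr0 // exprS; apply: GM. Qed.

Lemma bigO_expn_perturb m V Z h k : (0 < m)%N -> N 1 V -> N m Z ->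
  bigO m.+1 (fun t => h t - texp (t *: V) - t ^+ m *: Z) ->
  bigO m.+1 (fun t => h t ^+ k - texp (t *: (k%:R *: V)) - t ^+ m *: (k%:R *: Z)).
Proof.
move=> m_gt0 NV NZ Oh; elim: k => [|k IHk].
  apply: bigO_ext (bigO0 _) => t.
  by rewrite expr0 !scale0r !scaler0 texp0 subr0 subrr.
have NkV : N 1 (k%:R *: V) by apply: (filtZ filtN).
have NkZ : N m (k%:R *: Z) by apply: (filtZ filtN).
have OZ := bigO_monomial (leqnn m) NZ; have OkZ := bigO_monomial (leqnn m) NkZ.
have := bigO_mul_perturb m_gt0 (bigO_texp1 NkV) (bigO_texp1 NV) OkZ OZ IHk Oh.
apply: bigO_ext => t; rewrite exprSr -natr1.
have -> : texp (t *: ((k%:R + 1) *: V)) = texp (t *: (k%:R *: V)) * texp (t *: V).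
  by rewrite !scalerA texp_add // mulrDr mulr1.
by lmod_eq 'F_p.
Qed.

(** If h : F_p -> G starts with 1 + tV, then exp V is in G: the tangent vector of a
    curve in G exponentiates into G. The curve is corrected order by order. If
    h(t) = exp(tV) + t^m Z + O(t^(m+1)), then h(2t) h(t)^(-2^m) starts with
    exp((2 - 2^m) tV) and has no term of order m, and 2 - 2^m is invertible; after
    finitely many steps the error vanishes. *)
Lemma tangent_texp_in V h : N 1 V -> (forall t, G (h t)) ->
  bigO 2 (fun t => h t - 1 - t *: V) -> G (texp V).
Proof.
move=> NV Gh Oh.
suff [h' Gh' Oh'] : exists2 h', forall t, G (h' t)
    & bigO n (fun t => h' t - texp (t *: V)).
  have /eqP := bigO_vanish 1 Oh'; rewrite subr_eq0 scale1r => /eqP <-.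
  exact: Gh'.
suff: forall m, (2 <= m <= n)%N -> exists2 h', forall t, G (h' t)
    & bigO m (fun t => h' t - texp (t *: V)).
  by apply; rewrite n_gt1 leqnn.
elim=> [//|[//|[_ _|m IHm /andP[_ lemn]]]].
  exists h => //; apply: bigO_ext (bigO_sub Oh (bigO_texp2 NV)) => t.
  by lmod_eq 'F_p.
have{IHm} [|h' Gh' Oh'] := IHm; first exact: ltnW.
have [Z NZ OZ] := bigO_lead Oh'; set l := m.+2 in Oh' NZ OZ lemn *.
(* A natural number congruent to - 2 ^ l, for the exponent of h'(t). *)
pose k : nat := - 2%:R ^+ l :> F.
have kE : k%:R = - 2%:R ^+ l :> F by rewrite natr_Zp.
have N2V : N 1 (2%:R *: V) by apply: (filtZ filtN).
have NkV : N 1 (k%:R *: V) by apply: (filtZ filtN).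
have NkZ : N l (k%:R *: Z) by apply: (filtZ filtN).
have N2Z : N l (2%:R ^+ l *: Z) by apply: (filtZ filtN).
have O2 := bigO_dilate 2%:R OZ.
have Ok := bigO_expn_perturb k (ltn0Sn m.+1) NV NZ OZ.
have c_neq0 : 2%:R + k%:R != 0 :> F.
  have := @exp2_neq_Fp p n 1 l p_pr n_small.
  by rewrite (ltnW lemn) expr1 kE subr_eq0 => /(_ isT).
have := bigO_mul_perturb (ltn0Sn m.+1) (bigO_texp1 N2V) (bigO_texp1 NkV)
  (bigO_monomial (leqnn _) N2Z) (bigO_monomial (leqnn _) NkZ) _ Ok.
move=> /(_ (fun t => h' (2%:R * t))) Omul.
exists (fun t => let s := (2%:R + k%:R)^-1 * t in h' (2%:R * s) * h' s ^+ k).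
  by move=> t; apply: GM; [apply: Gh' | apply/subgroupX/Gh'].
have {}Omul : bigO l.+1 (fun t => h' (2%:R * t) * h' t ^+ k
                                   - texp (t *: ((2%:R + k%:R) *: V))).
  apply: bigO_ext (Omul _) => [t|].
    rewrite -scalerDr -scalerDl {2}kE addrN scale0r scaler0 subr0.
    by rewrite !scalerA texp_add // -mulrDr.
  apply: bigO_ext O2 => t; congr (_ - texp _ - _); first by rewrite scalerA mulrC.
  by rewrite exprMn scalerA mulrC.
apply: bigO_ext (bigO_dilate (2%:R + k%:R)^-1 Omul) => t /=.
by rewrite scalerA mulrAC mulVf // mul1r.
Qed.

(** The logarithms of the elements of G. *)
Definition liealg (X : R) : Prop := N 1 X /\ G (texp X).

Lemma liealgZ c X : liealg X -> liealg (c *: X).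
Proof.
move=> [NX GX]; split; first exact: (filtZ filtN).
by rewrite -[c]natr_Zp texp_natmul //; apply: subgroupX.
Qed.

Lemma liealg_tangent V h : N 1 V -> (forall t, G (h t)) ->
  bigO 2 (fun t => h t - 1 - t *: V) -> liealg V.
Proof. by move=> NV Gh Oh; split=> //; apply: tangent_texp_in Oh. Qed.

(** The curve exp (tX) exp (tY) in G has the tangent vector X + Y. *)
Lemma liealgD X Y : liealg X -> liealg Y -> liealg (X + Y).
Proof.
move=> gX gY; have [NX _] := gX; have [NY _] := gY.
apply: (@liealg_tangent _ (fun t => texp (t *: X) * texp (t *: Y))).
- exact: (filtD filtN).
- by move=> t; apply: GM; [case: (liealgZ t gX) | case: (liealgZ t gY)].
have := bigO_mul_perturb (isT : (0 < 1)%N) (a0 := fun=> 1) (b0 := fun=> 1) _ _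
  (bigO_linear NX) (bigO_linear NY) (bigO_texp2 NX) (bigO_texp2 NY).
have O0 : bigO 1 (fun=> 1 - 1) by apply: bigO_ext (bigO0 1) => t; rewrite subrr.
by move=> /(_ O0 O0); apply: bigO_ext => t; rewrite mulr1 scalerDr.
Qed.

(** The curve exp (f(t)) in G has the same tangent vector as f(t). *)
Lemma liealg_linear_tangent V f : N 1 V -> (forall t, liealg (f t)) ->
  bigO 2 (fun t => f t - t *: V) -> liealg V.
Proof.
move=> NV gf Of; apply: (@liealg_tangent V (fun t => texp (f t))) => //.
  by move=> t; case: (gf t).
have Of1 : bigO 1 f.
  have O2 := bigO_le (isT : (1 <= 2)%N) Of.
  by apply: bigO_ext (bigO_add O2 (bigO_linear NV)) => t; rewrite subrK.
have OfX k : bigO k (fun t => f t ^+ k).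
  elim: k => [|k IHk]; first exact: bigO_const (filt1 filtN).
  rewrite -addn1; apply: bigO_ext (bigO_mul IHk Of1) => t.
  by rewrite addn1 exprSr.
have Otail : bigO 2 (fun t => \sum_(2 <= i < n | (1 < i)%N)
    (i`!%:R : F)^-1 *: f t ^+ i).
  apply: bigO_sum => i i_gt1; apply: bigO_le i_gt1 _.
  exact/bigO_scale/OfX.
apply: bigO_ext (bigO_add Of Otail) => t; rewrite texpE.
rewrite [in RHS]big_nat_cond (_ : \sum_(2 <= i < n | (1 < i)%N) _ =
  \sum_(2 <= i < n | (2 <= i < n)%N && true) (i`!%:R : F)^-1 *: f t ^+ i).
  by lmod_eq 'F_p.
by rewrite big_nat_cond; apply: eq_bigl => i; case: (1 < i)%N; rewrite ?andbT.
Qed.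

Lemma texp_conj g g' X : g * g' = 1 -> g' * g = 1 ->
  texp (g * X * g') = g * texp X * g'.
Proof.
move=> gg' g'g; have conjX i : (g * X * g') ^+ i = g * X ^+ i * g'.
  elim: i => [|i IHi]; first by rewrite !expr0 mulr1 gg'.
  by rewrite exprS IHi !mulrA -(mulrA (g * X)) g'g mulr1 exprS !mulrA.
rewrite /texp mulr_sumr mulr_suml; apply: eq_bigr => i _.
by rewrite conjX -scalerAr -scalerAl.
Qed.

Lemma texp_opp_inv X : N 1 X -> texp X * texp (- X) = 1.
Proof.
move=> NX; rewrite -scaleN1r -{1}[X]scale1r texp_add //.
by rewrite subrr scale0r texp0.
Qed.

Lemma texp_filt0 X : N 1 X -> N 0 (texp X).
Proof.
move=> NX; apply: filt_sum => i _; apply: (filtZ filtN).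
exact: filt_le (leq0n i) (filtX i NX).
Qed.

(** G acts on its logarithms by conjugation, and Y |-> [X, Y] is the derivative at
    t = 0 of the conjugation by exp (tX). *)
Lemma liealg_bracket X Y : liealg X -> liealg Y -> liealg (X * Y - Y * X).
Proof.
move=> gX gY; have [NX _] := gX; have [NY GY] := gY.
have NNX : N 1 (- X) by rewrite -scaleN1r; apply: (filtZ filtN).
have NXY : N 1 (X * Y) by apply: (filtS filtN); apply: (filtM filtN (i := 1) (j := 1)).
have NYX : N 1 (Y * X) by apply: (filtS filtN); apply: (filtM filtN (i := 1) (j := 1)).
apply: (@liealg_linear_tangent _
  (fun t => texp (t *: X) * Y * texp (t *: - X) + (-1) *: Y)); first exact: filtB.
  move=> t; apply: liealgD; last exact: liealgZ.
  have NtX : N 1 (t *: X) by apply: (filtZ filtN).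
  have NtNX : N 1 (- (t *: X)) by rewrite -scalerN; apply: (filtZ filtN).
  have gtX := liealgZ t gX; have gtNX : liealg (- (t *: X)).
    by rewrite -scaleNr; apply: liealgZ.
  rewrite scalerN; split.
    rewrite -[1%N]addn0 -[X in (X + _)%N]add0n.
    by do !apply: (filtM filtN) => //; apply: texp_filt0.
  rewrite texp_conj; last 2 first.
  - exact: texp_opp_inv.
  - by rewrite -{2}[t *: X]opprK texp_opp_inv.
  by do !apply: GM => //; [case: gtX | case: gtNX].
have O1 := bigO_const (filt1 filtN).
have OB : bigO 0 (fun t => texp (t *: - X)).
  apply: bigO_ext (bigO_add (bigO_le (leq0n 1) (bigO_texp1 NNX)) O1) => t.
  by rewrite subrK.
have T1 := bigO_mul (bigO_mul (bigO_texp2 NX) (bigO_const NY)) OB.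
have T2 := bigO_mul (bigO_const NY) (bigO_texp2 NNX).
have T3 := bigO_mul (bigO_linear NXY) (bigO_texp1 NNX).
rewrite !addn0 add0n in T1 T2 T3.
apply: bigO_ext (bigO_add (bigO_add T1 T2) T3) => t.
rewrite !(mulrBl, mulrBr) !mul1r !mulr1 -!scalerAl -!scalerAr !mulrN ?mulrA.
by lmod_eq 'F_p.
Qed.

End Subgroup.
End Lazard.

(** * The affine group of a brace *)

(** A p-group acting linearly in characteristic p is unipotent: a nonzero quotient of
    the space has a nonzero fixed vector, so that the ascending chain U in which
    U (i + 1) consists of the vectors fixed modulo U i climbs up to the whole space. *)
Lemma pgroup_flag (p : nat) (F : fieldType) (gT : finGroupType) (G : {group gT})
    (d : nat) (rG : mx_representation F G d) :
  p \in [pchar F] -> (p.-group G)%g ->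
  exists U : nat -> 'M[F]_d, [/\ U 0 = 0, forall i, (U i <= U i.+1)%MS,
    forall i x, x \in G -> (U i.+1 *m (rG x - 1%:M) <= U i)%MS
    & row_full (U d)].
Proof.
move=> charFp pG.
pose next (W : 'M[F]_d) := (\bigcap_(x in G) kermx ((rG x - 1%:M) *m cokermx W))%MS.
pose U i := iter i next 0.
have sub_next m (v : 'M_(m, d)) W :
    reflect (forall x, x \in G -> (v *m (rG x - 1%:M) <= W)%MS) (v <= next W)%MS.
  apply: (iffP sub_bigcapmxP) => v_fix x Gx.
    by rewrite submxE -mulmxA; apply/eqP/sub_kermxP/v_fix.
  by apply/sub_kermxP/eqP; rewrite mulmxA -submxE; apply: v_fix.
have nextU i x : x \in G -> (U i.+1 *m (rG x - 1%:M) <= U i)%MS.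
  by move: x; apply/sub_next.
have sUU i : (U i <= U i.+1)%MS.
  elim: i => [|i IHi]; first exact: sub0mx.
  by apply/sub_next=> x Gx; apply: submx_trans (nextU i x Gx) IHi.
have modU i : mxmodule rG (U i).
  case: i => [|i]; first exact: mxmodule0.
  apply/mxmoduleP=> x Gx; rewrite -[rG x](subrK 1%:M) mulmxDr mulmx1 addmx_sub //.
  exact: submx_trans (nextU i x Gx) (sUU i).
exists U; split=> //; rewrite /row_full eqn_leq rank_leq_row /=.
suff: forall i, (minn i d <= \rank (U i))%N by move/(_ d); rewrite minnn.
elim=> [|i IHi]; first by rewrite min0n.
have [fullU|] := boolP (row_full (U i)).
  by apply: leq_trans (geq_minr _ _) _; rewrite -[X in (X <= _)%N](eqP fullU) mxrankS.
rewrite -cokermx_eq0 -mxrank_eq0 -lt0n => coker_gt0.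
have := rfix_pgroup_pchar charFp (factmod_repr (modU i)) coker_gt0 pG (subxx G).
set W := rfix_mx _ _ => W_neq0.
have ltUU : (U i < U i.+1)%MS.
  rewrite ltmxE sUU /=; apply: contra W_neq0 => sUU'.
  rewrite -(val_factmodK W) in_factmod_eq0; apply: submx_trans sUU'.
  apply/sub_next=> x Gx; rewrite mulmxBr mulmx1 -in_factmod_eq0 linearB /=.
  rewrite (in_factmodJ (modU i)) // val_factmodK.
  by rewrite (rfix_mx_id (factmod_repr (modU i))) // subrr.
apply: leq_trans (rank_ltmx ltUU); apply: leq_trans (_ : (minn i d).+1 <= _)%N.
  by rewrite -minnSS leq_min geq_minl (leq_trans (geq_minr _ _)).
by rewrite ltnS.
Qed.

Section BraceBasics.

Variables (A : zmodType) (B : left_brace A).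

Definition lam (a b : A) : A := B a b - a.

Lemma circE a b : B a b = a + lam a b.
Proof. by rewrite addrC subrK. Qed.

Lemma circ0r a : B a 0 = a.
Proof. by apply: (addrI (B a 0)); rewrite -circDr addr0. Qed.

Lemma circ1_eq0 : circ1 B = 0.
Proof. by rewrite -[LHS](circ0r (circ1 B)) circ1l. Qed.

Lemma lamD a : {morph lam a : b c / b + c}.
Proof.
by move=> b c; rewrite /lam addrACA -circDr addrA addrK.
Qed.

Lemma lamB a : {morph lam a : b c / b - c}.
Proof.
by move=> b c; apply: (addIr (lam a c)); rewrite -lamD !subrK.
Qed.

Lemma lam_circ a b c : lam (B a b) c = lam a (lam b c).
Proof. by rewrite [lam b c]/lam lamB /lam circA opprB addrA subrK. Qed.

Lemma lam0 b : lam 0 b = b.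
Proof. by rewrite /lam -circ1_eq0 circ1l circ1_eq0 subr0. Qed.

End BraceBasics.

(** The group of the brace B with the opposite multiplication, which makes it act on
    row vectors on the right. *)
Definition opgroup (F : finFieldType) (A : vectType F) (B : left_brace A) : Type :=
  finvect_type A.

Section OppositeGroup.

Variables (F : finFieldType) (A : vectType F) (B : left_brace A).

HB.instance Definition _ := Finite.on (opgroup B).

Let op_mul (x y : opgroup B) : opgroup B := B y x.

Let op_mulA : associative op_mul.
Proof. by move=> x y z; rewrite /op_mul circA. Qed.

Let op_mul1 : left_id (circ1 B) op_mul.
Proof. by move=> x; rewrite /op_mul circ1r. Qed.

Let op_mulV : left_inverse (circ1 B) (circV B) op_mul.
Proof. by move=> x; rewrite /op_mul circVr. Qed.

HB.instance Definition _ := Finite_isGroup.Build (opgroup B) op_mulA op_mul1 op_mulV.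

End OppositeGroup.

Section BraceLog.

Variables (p : nat) (p_pr : prime p) (A : vectType 'F_p) (B : left_brace A).
Hypothesis FB : is_F_brace B.

Local Notation F := 'F_p.
Local Notation d := (dim A).
Local Notation n := d.+1.

Lemma lamZ a c b : lam B a (c *: b) = c *: lam B a b.
Proof.
have starE b' : lam B a b' = star B a b' + b' by rewrite /star subrK.
by rewrite !starE FB -scalerDr.
Qed.

Definition lam_mx (a : A) : 'M[F]_d := lin1_mx (fun u => v2r (lam B a (r2v u))).

Lemma mul_lam_mx a u : u *m lam_mx a = v2r (lam B a (r2v u)).
Proof.
have f_lin : linear (fun u => v2r (lam B a (r2v u))).
  by move=> c v w; rewrite !linearP lamD lamZ linearP.
pose fM := GRing.isLinear.Build _ _ _ _ _ f_lin.
pose f : {linear 'rV_d -> 'rV_d} := HB.pack (fun u => v2r (lam B a (r2v u))) fM.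
exact: (mul_rV_lin1 f).
Qed.

Lemma lam_mx0 : lam_mx 0 = 1%:M.
Proof.
by apply/row_matrixP=> i; rewrite !rowE mul_lam_mx lam0 r2vK mulmx1.
Qed.

Lemma lam_mx_circ a b : lam_mx (B b a) = lam_mx a *m lam_mx b.
Proof.
by apply/row_matrixP=> i; rewrite !rowE mulmxA !mul_lam_mx v2rK lam_circ.
Qed.

Lemma lam_mx_repr : mx_repr [set: opgroup B]%G (lam_mx : opgroup B -> 'M_d).
Proof. by split=> [|x y _ _]; [rewrite -lam_mx0 -(circ1_eq0 B) | exact: lam_mx_circ]. Qed.

Canonical lam_mx_representation := MxRepresentation lam_mx_repr.

Lemma card_finvect : #|finvect_type A| = (p ^ d)%N.
Proof.
have := @card_vspacef _ (finvect_type A) (Vector.class (finvect_type A : vectType F)).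
by rewrite card_vspace card_Fp // => <-; rewrite -dimvf.
Qed.

Lemma pgroup_opgroup : p.-group%g [set: opgroup B].
Proof. by rewrite /pgroup cardsT card_finvect pnatX pnat_id. Qed.

(** The map b |-> a + lam_a b, on row vectors (1, b). *)
Definition affine_mx (a : A) : 'M[F]_(1 + d) := block_mx 1%:M (v2r a) 0 (lam_mx a).

Lemma affine_mx0 : affine_mx 0 = 1.
Proof. by rewrite /affine_mx linear0 lam_mx0 -scalar_mx_block. Qed.

Lemma affine_mx_sub1 a : affine_mx a - 1 = block_mx 0 (v2r a) 0 (lam_mx a - 1%:M).
Proof.
rewrite -affine_mx0 /affine_mx linear0 lam_mx0 opp_block_mx add_block_mx.
by rewrite subrr !subr0.
Qed.

Lemma affine_mx_circ a b : affine_mx (B b a) = affine_mx a * affine_mx b.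
Proof.
rewrite /affine_mx -mulmxE mulmx_block !mul1mx !mul0mx !mulmx0 !addr0 add0r.
by rewrite lam_mx_circ mul_lam_mx v2rK circE linearD.
Qed.

Lemma affine_mx_inj : injective affine_mx.
Proof. by move=> a b /eq_block_mx[_ /v2r_inj]. Qed.

(** The affine matrices act on 'rV_(1 + d) with the flag made of the whole space and
    of the flag U of pgroup_flag in the hyperplane of translations. *)
Lemma affine_filtration : exists N : nat -> 'M[F]_(1 + d) -> Prop,
  [/\ filtration n N, forall a, N 1 (affine_mx a - 1),
      forall X, N 1 X -> X = block_mx 0 (ursubmx X) 0 (drsubmx X)
    & forall X, N d X -> drsubmx X = 0].
Proof.
have [U [U0 leUS U_lam U_full]] :=
  pgroup_flag lam_mx_representation (pchar_Fp p_pr) pgroup_opgroup.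
pose W i := block_mx 0 0 0 (U i) : 'M[F]_(1 + d).
pose V j : 'M[F]_(1 + d) := if j is 0 then 1%:M else W (n - j)%N.
have leU i k : (i <= k)%N -> (U i <= U k)%MS.
  move=> leik; rewrite -(subnK leik); elim: (k - i)%N => // l IHl.
  exact: submx_trans IHl (leUS _).
have W_sub m (v : 'M_(m, d)) M i : (v <= U i)%MS -> (M <= U i)%MS ->
    (block_mx 0 v 0 M <= W i)%MS.
  move=> /submxP[v' ->] /submxP[M' ->]; apply/submxP; exists (block_mx 0 v' 0 M').
  by rewrite mulmx_block !mulmx0 !add0r.
have V_sub j : (V j.+1 <= V j)%MS.
  case: j => [|j]; first exact: submx1.
  by apply: W_sub; rewrite ?sub0mx // leU // !subSS leq_sub2l.
exists (fun i X => forall j, (V j *m X <= V (j + i)%N)%MS); split.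
- split=> [i j|i X Y NX NY j|i c X NX j|j|i k X Y NX NY j|i X NX j|X NX].
  + by rewrite mulmx0 sub0mx.
  + by rewrite mulmxDr addmx_sub.
  + by rewrite -scalemxAr scalemx_sub.
  + by rewrite mulmx1 addn0.
  + by rewrite -mulmxE mulmxA addnA; apply: submx_trans (NY _); apply: submxMr.
  + by apply: submx_trans (NX j) _; rewrite addnS.
  have := NX 0%N; rewrite mul1mx add0n /V /W subnn U0.
  by rewrite (_ : block_mx 0 0 0 0 = 0) ?submx0 => [/eqP|]; rewrite ?block_mx0.
- move=> a [|j].
    rewrite mul1mx addn1 /= subSS subn0 affine_mx_sub1.
    by apply: W_sub; apply: submx_full.
  rewrite affine_mx_sub1 mulmx_block !mulmx0 !mul0mx !addr0 !add0r addn1 /=.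
  apply: W_sub; first exact: sub0mx.
  have [ltjd|ledj] := ltnP j d.
    by rewrite !subSS -[(d - j)%N]prednK ?subn_gt0 // -subnS U_lam ?inE.
  by rewrite !subSS (eqP (ledj : (d - j)%N == 0%N)) U0 mul0mx sub0mx.
- move=> X /(_ 0%N); rewrite mul1mx => /submxP[D ->].
  rewrite -[D]submxK /V /W mulmx_block !mulmx0 !addr0 !add0r.
  by rewrite block_mxKur block_mxKdr.
move=> X NX; have : (V 1%N *m X <= V n)%MS := NX 1%N.
rewrite /V subSS subn0 subnn /W U0 block_mx0 submx0 => /eqP.
rewrite -[X in _ *m X]submxK mulmx_block !mul0mx !add0r -block_mx0.
case/eq_block_mx=> _ _ _ UX0; apply: (row_full_inj U_full).
by rewrite UX0 mulmx0.
Qed.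

End BraceLog.

(** * The pre-Lie algebra of a brace *)

Section BlockProjections.

Variables (R : pzRingType) (m1 m2 n1 n2 : nat).

Fact ursubmx_is_linear : linear (@ursubmx R m1 m2 n1 n2).
Proof. by move=> c X Y; apply/matrixP=> i j; rewrite !mxE. Qed.

Fact drsubmx_is_linear : linear (@drsubmx R m1 m2 n1 n2).
Proof. by move=> c X Y; apply/matrixP=> i j; rewrite !mxE. Qed.

HB.instance Definition _ := GRing.isLinear.Build R _ _ _ _ ursubmx_is_linear.
HB.instance Definition _ := GRing.isLinear.Build R _ _ _ _ drsubmx_is_linear.

End BlockProjections.

Lemma block_mx_exp (R : nzRingType) (d : nat) (X : 'M[R]_(1 + d)) (i : nat) :
  X = block_mx 0 (ursubmx X) 0 (drsubmx X) ->
  X ^+ i.+1 = block_mx 0 (ursubmx X *m drsubmx X ^+ i) 0 (drsubmx X ^+ i.+1).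
Proof.
move=> defX; elim: i => [|i IHi].
  by rewrite !expr1 expr0 mulmx1.
rewrite exprSr IHi [Y in _ * Y]defX -mulmxE mulmx_block !mulmx0 !mul0mx !add0r.
by rewrite -mulmxA [in RHS]exprSr [in RHS]exprSr.
Qed.

Section BraceFlows.

Variables (p : nat) (p_pr : prime p) (A : vectType 'F_p) (B : left_brace A).
Hypothesis FB : is_F_brace B.

Local Notation F := 'F_p.
Local Notation d := (dim A).
Local Notation n := d.+1.
Hypotheses (d_gt0 : (0 < d)%N) (n_small : (2 ^ n <= p)%N).

Lemma iter_mulmx (f : A -> A) (M : 'M[F]_d) (i : nat) b :
  (forall v, f v = r2v (v2r v *m M)) -> iter i f b = r2v (v2r b *m M ^+ i).
Proof.
move=> fE; elim: i => [|i IHi] /=; first by rewrite expr0 mulmx1 v2rK.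
by rewrite IHi fE r2vK exprSr -mulmxE mulmxA.
Qed.

(** Every brace of order p^d with p large is the group of flows of a pre-Lie algebra
    all of whose left multiplications lie in a nilpotent algebra. The logarithms X of
    the affine maps b |-> a + lam_a b form a Lie algebra; X has the translation part
    v = Omega(a) and the linear part L_v; since no map b |-> a o b with a <> 0 fixes 0,
    X is determined by v, and every v occurs because Omega is an injection of
    the finite set A. The product is v . w = L_v w: linear in v as the
    logarithms form a subspace, and the pre-Lie identity [L_v, L_w] = L_(v.w - w.v)
    says that they are closed under brackets. *)
Theorem brace_flows : exists (mul : A -> A -> A) (Omega : A -> A),
  [/\ is_pre_lie mul,
      cancel (flowW mul d) Omega, cancel Omega (flowW mul d),
      forall a b, B a b = a + expL mul n (Omega a) b
    & forall s b, (d <= size s)%N -> foldr mul b s = 0].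
Proof.
have [N [filtN N_aff N_shape N_lin0]] := affine_filtration p_pr FB.
have n_gt1 : (1 < n)%N by [].
pose G g := exists a, g = affine_mx B a.
have G1 : G 1 by exists 0; rewrite (affine_mx0 FB).
have GM g h : G g -> G h -> G (g * h).
  by move=> [a ->] [b ->]; exists (B b a); rewrite (affine_mx_circ FB).
have logP (a : finvect_type A) : exists X, N 1 X /\ texp n X = affine_mx B a.
  by have [X] := texp_surj n_gt1 filtN (N_aff a); exists X.
have [ell ellP] := fin_all_exists logP.
have gell a : liealg n N G (ell a).
  by have [NX EX] := ellP a; split=> //; exists a.
pose om a : A := r2v (ursubmx (ell a)).
have urZ c (X : 'M[F]_(1 + d)) : ursubmx (c *: X) = c *: ursubmx X by exact: linearZ.
have drZ c (X : 'M[F]_(1 + d)) : drsubmx (c *: X) = c *: drsubmx X by exact: linearZ.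
have ursub_texp X : N 1 X -> ursubmx (texp n X : 'M[F]_(1 + d))
    = \sum_(1 <= i < n) (i`!%:R : F)^-1 *: (ursubmx X *m drsubmx X ^+ i.-1).
  move=> NX; rewrite /texp big_ltn // raddfD /= urZ expr0.
  rewrite (_ : ursubmx 1 = 0) ?scaler0 ?add0r; last first.
    by rewrite -(affine_mx0 FB) block_mxKur linear0.
  rewrite raddf_sum /=; apply: eq_big_nat => -[|i] // _.
  by rewrite urZ (block_mx_exp _ (N_shape X NX)) block_mxKur.
have drsub_texp X : N 1 X -> drsubmx (texp n X : 'M[F]_(1 + d))
    = \sum_(0 <= i < n) (i`!%:R : F)^-1 *: drsubmx X ^+ i.
  move=> NX; rewrite raddf_sum /=; apply: eq_bigr => -[|i] _; rewrite drZ.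
    by rewrite !expr0 -(affine_mx0 FB) block_mxKdr (lam_mx0 FB).
  by rewrite (block_mx_exp _ (N_shape X NX)) block_mxKdr.
have gD := liealgD p_pr n_gt1 n_small filtN G1 GM.
have gZ := liealgZ p_pr n_gt1 n_small filtN G1 GM.
have ell_unique (X : 'M[F]_(1 + d)) : liealg n N G X ->
    exists2 c, X = ell c & om c = r2v (ursubmx X).
  move=> gX; have [NX [c EX]] := gX; have [Nc Ec] := ellP c.
  have -> : X = ell c by apply: (texp_inj n_gt1 filtN NX Nc); rewrite EX Ec.
  by exists c.
(* If the logarithms of two elements have the same translation part, the exponential
   of their difference fixes 0, hence is the identity. *)
have om_inj : injective (om : finvect_type A -> finvect_type A).
  move=> a b /(congr1 v2r); rewrite !r2vK => eq_ur.
  have gX : liealg n N G (ell a + (-1) *: ell b) by apply/gD/gZ.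
  have [NX [c EX]] := gX.
  have ur0 : ursubmx (ell a + (-1) *: ell b) = 0.
    by rewrite raddfD /= urZ eq_ur scaleN1r subrr.
  have c0 : c = 0.
    apply: v2r_inj; rewrite linear0; have := congr1 (@ursubmx F 1 d 1 d) EX.
    rewrite block_mxKur ursub_texp // ur0 big1 // => i _.
    by rewrite mul0mx scaler0.
  have X0 : ell a + (-1) *: ell b = 0.
    apply: (texp_inj n_gt1 filtN NX (filt0 filtN 1%N)).
    by rewrite EX c0 (affine_mx0 FB) texp0.
  apply: (@affine_mx_inj p A B); case: (ellP a) => _ <-; case: (ellP b) => _ <-.
  by move/eqP: X0; rewrite scaleN1r subr_eq0 => /eqP ->.
have [W omK Wom] := injF_bij om_inj.
have ell_W (X : 'M[F]_(1 + d)) v : liealg n N G X -> ursubmx X = v2r v -> X = ell (W v).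
  by move=> gX urX; have [c Xc om_c] := ell_unique X gX; rewrite -(v2rK v) -urX -om_c omK.
pose M v : 'M[F]_d := drsubmx (ell (W v)).
have ellE v : ell (W v) = block_mx 0 (v2r v) 0 (M v).
  have [NX _] := ellP (W v); rewrite [LHS](N_shape _ NX) -/(M v); congr block_mx.
  by rewrite -[in RHS](Wom v) /om r2vK.
have M_linear c u v : M (c *: u + v) = c *: M u + M v.
  rewrite {1}/M -(@ell_W (c *: ell (W u) + ell (W v))).
  - by rewrite raddfD /= drZ.
  - by apply: gD => //; apply: gZ.
  - by rewrite raddfD /= urZ !ellE !block_mxKur linearP.
have M_sub u v : M (u - v) = M u - M v.
  by rewrite (addrC u) -scaleN1r M_linear scaleN1r addrC.
pose mul u v : A := r2v (v2r v *m M u).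
have mulBl u v w : mul (u - v) w = mul u w - mul v w.
  by rewrite /mul M_sub mulmxBr linearB.
have mulmul u v w : mul u (mul v w) = r2v (v2r w *m M v *m M u).
  by rewrite {1}/mul r2vK.
have M_bracket u v : M (mul u v - mul v u) = M v *m M u - M u *m M v.
  rewrite {1}/M -(@ell_W (ell (W v) * ell (W u) - ell (W u) * ell (W v))).
  - rewrite !ellE -!mulmxE !mulmx_block opp_block_mx add_block_mx block_mxKdr.
    by rewrite !mul0mx !add0r.
  - exact: (liealg_bracket p_pr n_gt1 n_small filtN G1 GM).
  - rewrite !ellE -!mulmxE !mulmx_block opp_block_mx add_block_mx block_mxKur.
    by rewrite !mul0mx !add0r linearB /= !r2vK.
have flow_om a : flowW mul d (om a) = a.
  have [NX EX] := ellP a; have := congr1 (@ursubmx F 1 d 1 d) EX.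
  rewrite block_mxKur ursub_texp // => defa.
  apply: v2r_inj; rewrite -defa linear_sum; apply: eq_bigr => i _.
  rewrite linearZ /= (@iter_mulmx _ (M (om a))) // r2vK {1}/om r2vK.
  by rewrite /M omK.
exists mul, om; split.
- split=> [a c u v|b c u v|x y z].
  + by rewrite /mul linearP mulmxDl -scalemxAl linearP.
  + by rewrite /mul M_linear mulmxDr -scalemxAr linearP.
  have : mul (mul x y) z - mul (mul y x) z = mul x (mul y z) - mul y (mul x z).
    rewrite -mulBl mulmul [mul (_ - _) z]/mul M_bracket mulmxBr linearB /= !mulmxA.
    by rewrite mulmul.
  move: (mul (mul x y) z) (mul (mul y x) z) (mul x (mul y z)) (mul y (mul x z)).
  move=> xy_z yx_z x_yz y_xz.
  move=> /eqP; rewrite subr_eq => /eqP ->.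
  by rewrite addrAC [x_yz - _]addrC addrK addrC.
- by move=> u; rewrite -{1}(Wom u) flow_om Wom.
- exact: flow_om.
- move=> a b; have [NX EX] := ellP a; have := congr1 (@drsubmx F 1 d 1 d) EX.
  rewrite block_mxKdr drsub_texp // circE => defa; congr (_ + _).
  apply: v2r_inj; rewrite -[b in LHS]v2rK -(mul_lam_mx FB) -defa mulmx_sumr linear_sum.
  apply: eq_bigr => i _.
  rewrite -scalemxAr [RHS]linearZ /= (@iter_mulmx _ (M (om a))) // r2vK.
  by rewrite /M omK.
move=> s b le_ds.
suff [X NX ->] : exists2 X, N (size s) X & foldr mul b s = r2v (v2r b *m drsubmx X).
  by rewrite (N_lin0 _ (filt_le filtN le_ds NX)) mulmx0 linear0.
suff [X [NX _ ->]] : exists X, [/\ N (size s) X, dlsubmx X = 0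
    & foldr mul b s = r2v (v2r b *m drsubmx X)] by exists X.
elim: s {le_ds} => [|a s [X [NX X0 IHs]]] /=.
  exists 1; split; first exact: filt1 filtN.
    by rewrite -(affine_mx0 FB) block_mxKdl.
  by rewrite -(affine_mx0 FB) block_mxKdr (lam_mx0 FB) mulmx1 v2rK.
exists (X * ell (W a)); split.
- by rewrite -addn1; apply: (filtM filtN) => //; case: (ellP (W a)).
- by rewrite -(submxK X) ellE -mulmxE mulmx_block block_mxKdl !mulmx0 addr0.
- rewrite IHs /mul r2vK -(submxK X) ellE -mulmxE mulmx_block !block_mxKdr X0.
  by rewrite mul0mx add0r mulmxA.
Qed.

End BraceFlows.

(** * Nilpotency of left and right nilpotent pre-Lie algebras *)

Lemma span_ind (F : fieldType) (A : vectType F) (P : A -> Prop) (s : seq A) :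
  P 0 -> (forall u v, P u -> P v -> P (u + v)) -> (forall c u, P u -> P (c *: u)) ->
  (forall u, u \in s -> P u) -> forall v, v \in <<s>>%VS -> P v.
Proof.
move=> P0 PD PZ Ps v; rewrite -[s]/(val (in_tuple s)) => /coord_span ->.
apply: (big_ind P) => // i _; apply/PZ/Ps/mem_nth.
exact: ltn_ord.
Qed.

Section PreLieNilpotency.

Variables (F : finFieldType) (A : vectType F) (mul : A -> A -> A).
Hypothesis mulP : is_pre_lie mul.

Implicit Types (U V W I : {vspace A}) (u v w : A).

Lemma pmulDl u v w : mul (u + v) w = mul u w + mul v w.
Proof. by have := pre_lie_linearl mulP w 1 u v; rewrite /= !scale1r. Qed.

Lemma pmulDr u v w : mul u (v + w) = mul u v + mul u w.
Proof. by have := pre_lie_linearr mulP u 1 v w; rewrite /= !scale1r. Qed.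

Lemma pmul0l w : mul 0 w = 0.
Proof. by apply: (addrI (mul 0 w)); rewrite -pmulDl !addr0. Qed.

Lemma pmul0r w : mul w 0 = 0.
Proof. by apply: (addrI (mul w 0)); rewrite -pmulDr !addr0. Qed.

Lemma pmulZl c u w : mul (c *: u) w = c *: mul u w.
Proof. by have := pre_lie_linearl mulP w c u 0; rewrite /= addr0 pmul0l addr0. Qed.

Lemma pmulZr c u w : mul u (c *: w) = c *: mul u w.
Proof. by have := pre_lie_linearr mulP u c w 0; rewrite /= addr0 pmul0r addr0. Qed.

Definition vlist U : seq A := enum [pred u : finvect_type A | u \in U].

Lemma mem_vlist U u : (u \in vlist U) = (u \in U).
Proof. exact: (mem_enum [pred u : finvect_type A | u \in U] u). Qed.

Definition mulv U V : {vspace A} := <<[seq mul u v | u <- vlist U, v <- vlist V]>>.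

Lemma mem_mulv U V u v : u \in U -> v \in V -> mul u v \in mulv U V.
Proof.
move=> Uu Vv; apply/memv_span/allpairsP; exists (u, v).
by rewrite !mem_vlist.
Qed.

Lemma mulv_ind (P : A -> Prop) U V :
  P 0 -> (forall u v, P u -> P v -> P (u + v)) -> (forall c u, P u -> P (c *: u)) ->
  (forall u v, u \in U -> v \in V -> P (mul u v)) -> forall v, v \in mulv U V -> P v.
Proof.
move=> P0 PD PZ PUV; apply: span_ind => // _ /allpairsP[[u v] /= [Uu Vv ->]].
by rewrite !mem_vlist in Uu Vv; apply: PUV.
Qed.

Lemma mulv_subP U V W :
  reflect (forall u v, u \in U -> v \in V -> mul u v \in W) (mulv U V <= W)%VS.
Proof.
apply: (iffP subvP) => [sW u v Uu Vv|UV_W]; first exact/sW/mem_mulv.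
apply: mulv_ind => //; first exact: mem0v.
- by move=> u v; apply: rpredD.
- by move=> c u; apply: rpredZ.
Qed.

Lemma mulvS U U' V V' : (U <= U')%VS -> (V <= V')%VS -> (mulv U V <= mulv U' V')%VS.
Proof.
by move=> /subvP sU /subvP sV; apply/mulv_subP=> u v /sU Uu /sV Vv; apply: mem_mulv.
Qed.

Definition right_power (i : nat) : {vspace A} := iter i (fun V => mulv V fullv) fullv.
Definition left_power (i : nat) : {vspace A} := iter i (mulv fullv) fullv.

(** Both one-sided multiples, so that the descending series below consists of
    two-sided ideals. *)
Definition ideal_mul (V : {vspace A}) : {vspace A} := (mulv fullv V + mulv V fullv)%VS.
Definition ideal_power (i : nat) : {vspace A} := iter i ideal_mul fullv.

Lemma right_powerS i : (right_power i.+1 <= right_power i)%VS.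
Proof.
elim: i => [|i IHi]; first exact: subvf.
exact: mulvS IHi (subvv _).
Qed.

(** The pre-Lie identity x(ra) = (xr)a - (rx)a + r(xa) makes the right powers left
    ideals too. *)
Lemma right_power_ideal i : (mulv fullv (right_power i) <= right_power i)%VS.
Proof.
elim: i => [|i /mulv_subP IHi]; first exact: subvf.
apply/mulv_subP => x v _; move: v.
apply: (@mulv_ind (fun v => mul x v \in right_power i.+1)) => [|u v xu xv|c u xu|r a Rr _].
- by rewrite pmul0r mem0v.
- by rewrite pmulDr rpredD.
- by rewrite pmulZr rpredZ.
have law := pre_lie_law mulP x r a.
have -> : mul x (mul r a) = mul (mul x r) a - (mul (mul x r) a - mul x (mul r a)).
  by rewrite subKr.
have Rrx : mul r x \in right_power i.
  exact: (subvP (right_powerS i) _ (mem_mulv Rr (memvf x))).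
have Rxr : mul x r \in right_power i by apply: IHi; rewrite ?memvf.
by rewrite law !memvB ?mem_mulv ?memvf.
Qed.

Lemma ideal_power_antitone i : (ideal_power i.+1 <= ideal_power i)%VS.
Proof.
elim: i => [|i IHi]; first exact: subvf.
by apply: addvS; apply: mulvS.
Qed.

Variables (l r : nat).
Hypotheses (left0 : left_power l = 0%VS) (right0 : right_power r = 0%VS).

(** If I = AI + IA lies in the right power R_i, then I lies in R_(i+1) + A I, hence in
    R_(i+1) + A (A I) and so on, and the left multiplications are nilpotent. *)
Lemma ideal_mul_fixed I : (I <= ideal_mul I)%VS -> I = 0%VS.
Proof.
move=> sI; apply/eqP; rewrite -subv0 -right0; elim: (r) => [|i IHi]; first exact: subvf.
suff: forall m, (I <= right_power i.+1 + left_power m)%VS.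
  by move/(_ l); rewrite left0 addv0.
elim=> [|m IHm]; first by rewrite (subv_trans (subvf _)) ?addvSr.
apply: subv_trans sI _; rewrite subv_add; apply/andP; split; last first.
  by apply: subv_trans (addvSl _ _); apply: mulvS.
apply: subv_trans (mulvS (subvv _) IHm) _; apply/mulv_subP=> x v _.
case/memv_addP=> y Ry [z Lz ->]; rewrite pmulDr memv_add //.
  by apply: (mulv_subP _ _ _ (right_power_ideal i.+1)); rewrite ?memvf.
by apply: mem_mulv; rewrite ?memvf.
Qed.

Lemma ideal_power_vanish : ideal_power (dim A) = 0%VS.
Proof.
suff: forall i, (\dim (ideal_power i) <= dim A - i)%N.
  by move/(_ (dim A)); rewrite subnn leqn0 dimv_eq0 => /eqP.
elim=> [|i IHi]; first by rewrite subn0 dimvf.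
have [le_dim|lt_dim] := leqP (\dim (ideal_power i)) (\dim (ideal_power i.+1)).
  have eqI : ideal_power i.+1 = ideal_power i.
    by apply/eqP; rewrite eqEdim ideal_power_antitone.
  by rewrite eqI (ideal_mul_fixed (I := ideal_power i)) ?dimv0 // -{1}eqI.
by rewrite subnS -ltnS (leq_trans lt_dim) // (leq_trans IHi) // leqSpred.
Qed.

(** One of the two factors of a product of 2 ^ (i + 1) letters has 2 ^ i letters. *)
Lemma evalb_ideal_power (T : Type) (f : T -> A) (t : bracketing T) i :
  (2 ^ i <= nletters t)%N -> evalb mul f t \in ideal_power i.
Proof.
elim: i t => [|i IHi] t; first by rewrite memvf.
case: t => [a|u v] /=; first by rewrite leqNgt -[1%N](expn0 2) ltn_exp2l.
move=> le2; have [le_u|lt_u] := leqP (2 ^ i) (nletters u).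
  apply: (subvP (addvSr _ _)); apply: mem_mulv (_ : _ \in _) (memvf _).
  exact: IHi.
apply: (subvP (addvSl _ _)); apply: mem_mulv; first exact: memvf.
apply: IHi; rewrite leqNgt; apply: contraL le2 => lt_v.
by rewrite -ltnNge expnS mul2n -addnn -addnS leq_add // ltnW.
Qed.

Lemma products_vanish_big k : (2 ^ dim A <= k)%N -> products_vanish mul k.
Proof.
move=> le_k _ [t [size_t ->]]; apply/eqP.
by rewrite -memv0 -ideal_power_vanish evalb_ideal_power ?size_t.
Qed.

End PreLieNilpotency.

(** * Right series and subbraces in terms of the pre-Lie product *)

(** An element of the left power m is a combination of m-fold left multiples, so that
    m more left multiplications are available against it. *)
Lemma left_power_foldr (F : finFieldType) (A : vectType F) (mul : A -> A -> A) (l : nat) :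
  is_pre_lie mul -> (forall s b, (l <= size s)%N -> foldr mul b s = 0) ->
  left_power mul l = 0%VS.
Proof.
move=> mulP fold0; suff: forall m v, v \in left_power mul m ->
    forall s, (l <= size s + m)%N -> foldr mul v s = 0.
  move=> left_fold; apply/eqP; rewrite -subv0; apply/subvP=> v Lv.
  by have /= -> := left_fold l v Lv [::] (leqnn l); apply: mem0v.
elim=> [|m IHm] v; first by move=> _ s; rewrite addn0; apply: fold0.
have fold_0 s : foldr mul 0 s = 0 by elim: s => //= a s ->; rewrite pmul0r.
have foldD s u w : foldr mul (u + w) s = foldr mul u s + foldr mul w s.
  by elim: s => //= a s ->; rewrite pmulDr.
have foldZ s c u : foldr mul (c *: u) s = c *: foldr mul u s.
  by elim: s => //= a s ->; rewrite pmulZr.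
move: v; apply: mulv_ind => [s _|u w IHu IHw s le_s|c u IHu s le_s|a v _ Lv s le_s].
- exact: fold_0.
- by rewrite foldD IHu // IHw // addr0.
- by rewrite foldZ IHu // scaler0.
- by rewrite -foldr_rcons; apply: IHm => //; rewrite size_rcons addSnnS.
Qed.

(** f(2t) - 2^m f(t) has no term of the top order m, so that the degree of the curve f
    can be lowered until the first coefficient alone is left. *)
Lemma poly_curve_tangent (p : nat) (A : lmodType 'F_p) (S : A -> Prop) (n : nat)
    (c : nat -> A) :
  prime p -> (2 ^ n <= p)%N -> (1 < n)%N ->
  (forall u v, S u -> S v -> S (u + v)) -> (forall a u, S u -> S (a *: u)) ->
  (forall t : 'F_p, S (\sum_(1 <= i < n) t ^+ i *: c i)) -> S (c 1%N).
Proof.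
move=> p_pr n_small n_gt1 SD SZ; elim: n c n_small n_gt1 => [|[|[|n]]] // IHn c n_small _ Sc.
  by have := Sc 1; rewrite big_nat1 expr1 scale1r.
set m := n.+2 in IHn n_small Sc *.
have m_small : (2 ^ m <= p)%N by apply: leq_trans n_small; rewrite leq_exp2l.
have c_neq0 : 2 - 2 ^+ m != 0 :> 'F_p.
  rewrite subr_eq0 -[X in X != _]expr1.
  by apply: (exp2_neq_Fp p_pr m_small); rewrite leqnn andbT.
suff: S ((2 ^+ 1 - 2 ^+ m) *: c 1%N).
  by move/(SZ (2 - 2 ^+ m)^-1); rewrite scalerA expr1 mulVf // scale1r.
apply: (IHn (fun i => (2 ^+ i - 2 ^+ m) *: c i)) => // t.
have := SD _ _ (Sc (2 * t)) (SZ (- 2 ^+ m) _ (Sc t)); congr S.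
rewrite !(big_nat_recr m) //= scalerDr scaler_sumr addrACA -big_split /=.
rewrite exprMn !scalerA mulNr scaleNr subrr addr0; apply: eq_bigr => i _.
rewrite exprMn !scalerA -scalerDl; congr (_ *: _); ring.
Qed.

Section BraceToPreLie.

Variables (p : nat) (p_pr : prime p) (A : vectType 'F_p) (B : left_brace A).
Hypothesis FB : is_F_brace B.

Local Notation F := 'F_p.

Variables (mul : A -> A -> A) (d : nat) (Omega : A -> A).
Hypotheses (d_gt0 : (0 < d)%N) (n_small : (2 ^ d.+1 <= p)%N).
Hypothesis mulP : is_pre_lie mul.
Hypotheses (WK : cancel (flowW mul d) Omega) (OmegaK : cancel Omega (flowW mul d)).
Hypothesis flowB : forall a b, B a b = a + expL mul d.+1 (Omega a) b.

Lemma iter_mulZ t u b i : iter i (mul (t *: u)) b = t ^+ i *: iter i (mul u) b.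
Proof.
elim: i => [|i IHi] /=; first by rewrite expr0 scale1r.
by rewrite IHi (pmulZl mulP) (pmulZr mulP) scalerA exprS.
Qed.

Lemma star_flowW t u b :
  star B (flowW mul d (t *: u)) b
    = \sum_(1 <= i < d.+1) t ^+ i *: ((i`!%:R : F)^-1 *: iter i (mul u) b).
Proof.
rewrite /star flowB WK /expL big_ltn //= invr1 scale1r [_ + (b + _)]addrC addrK.
rewrite [b + _]addrC addrK; apply: eq_bigr => i _.
by rewrite iter_mulZ !scalerA mulrC.
Qed.

Lemma right_series_lin i :
  [/\ right_series B i 0,
      forall u v, right_series B i u -> right_series B i v -> right_series B i (u + v)
    & forall c u, right_series B i u -> right_series B i (c *: u)].
Proof.
case: i => [//|i]; split=> [|u v [s [Rs ->]] [s' [Rs' ->]]|c u [s [Rs ->]]] /=.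
- by exists [::]; rewrite big_nil.
- exists (s ++ s'); rewrite big_cat; split=> // w; rewrite mem_cat.
  by case/orP; [apply: Rs | apply: Rs'].
- exists [seq (w.1, c *: w.2) | w <- s]; split=> [_ /mapP[w sw ->]|]; first exact: (Rs w sw).
  by rewrite big_map scaler_sumr; apply: eq_bigr => w _; rewrite -FB.
Qed.

Lemma flowW_sub (U : {vspace A}) u : (forall v, v \in U -> mul u v \in U) ->
  u \in U -> flowW mul d u \in U.
Proof.
move=> Uu_stable Uu; apply: rpred_sum => i _; apply: rpredZ.
by elim: (i.-1) => //= j; apply: Uu_stable.
Qed.

(** For r in R_i the curve t |-> W(t r) stays in R_i, and the curve W(t r) * b has the
    tangent vector r . b. *)
Lemma right_power_sub_series i v : v \in right_power mul i -> right_series B i v.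
Proof.
elim: i v => [//|i IHi]; have [R0 RD RZ] := right_series_lin i.+1.
apply: mulv_ind => // r b Rr _.
have := @poly_curve_tangent p A (right_series B i.+1) d.+1
  (fun i => (i`!%:R : F)^-1 *: iter i (mul r) b) p_pr n_small d_gt0 RD RZ.
rewrite /= invr1 scale1r; apply=> t; rewrite -star_flowW.
exists [:: (flowW mul d (t *: r), b)]; rewrite big_seq1; split=> // w.
rewrite inE => /eqP -> /=; apply/IHi/flowW_sub; last by rewrite rpredZ.
move=> v Rv; apply: (subvP (right_powerS mul i)).
by apply: mem_mulv (memvf _); rewrite rpredZ.
Qed.

Lemma stable_inj_surj (U : {vspace A}) (f : A -> A) v :
  injective f -> (forall u, u \in U -> f u \in U) -> v \in U ->
  exists2 u, u \in U & f u = v.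
Proof.
move=> f_inj fU Uv; pose S := [set u : finvect_type A | u \in U].
have sfS : (f : finvect_type A -> finvect_type A) @: S \subset S.
  by apply/subsetP=> w /imsetP[u]; rewrite !inE => Uu ->; apply: fU.
have : (v : finvect_type A) \in (f : finvect_type A -> finvect_type A) @: S.
  have /eqP -> : (f : finvect_type A -> finvect_type A) @: S == S.
    rewrite eqEcard sfS -[#|_ @: _|]/(#|(f : finvect_type A -> finvect_type A) @: S|).
    by rewrite (card_imset (f := f : finvect_type A -> finvect_type A) _ f_inj) leqnn.
  by rewrite inE.
by case/imsetP=> u; rewrite inE => Uu vfu; exists u.
Qed.

(** Omega permutes a finite subalgebra, since its inverse W maps it injectively to
    itself; hence o, which is computed from Omega and the product, stays in it. *)
Lemma subalgebra_subbrace (U : {vspace A}) :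
  (forall u v, u \in U -> v \in U -> mul u v \in U) -> is_subbrace B (fun a => a \in U).
Proof.
move=> U_mul.
have circU a b : a \in U -> b \in U -> B a b \in U.
  move=> Ua Ub; have [u Uu <-] : exists2 u, u \in U & flowW mul d u = a.
    apply: stable_inj_surj => //; first exact: can_inj WK.
    by move=> u Uu; apply: flowW_sub => // v; apply: U_mul.
  rewrite flowB WK rpredD //; first by apply: flowW_sub => // v; apply: U_mul.
  apply: rpred_sum => i _; apply: rpredZ.
  by elim: i => //= i IHi; apply: U_mul.
split=> [|a b Ua Ub|||a Ua] //; rewrite ?circ1_eq0 ?mem0v ?rpredB //.
have [||u Uu Bu] := @stable_inj_surj U (B a) 0 _ _ (mem0v U).
- by move=> u v eqB; rewrite -[u](circ1l B) -(circVl B a) -circA eqB circA circVl circ1l.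
- by move=> u; apply: circU.
by rewrite -[circV B a](circ1r B) circ1_eq0 -Bu circA circVl circ1l.
Qed.

Lemma brace_generated_pre_lie x : brace_generated B x -> pre_lie_generated mul x.
Proof.
move=> genx U U_mul Ux; apply/eqP; rewrite eqEsubv subvf /=; apply/subvP=> a _.
exact: (genx (fun a => a \in U) (subalgebra_subbrace U_mul) Ux a).
Qed.

End BraceToPreLie.

(** * Powers of a pre-Lie algebra *)

Lemma memv_line_add (F : fieldType) (A : vectType F) (w : A) (W : {vspace A}) v :
  v \in (<[w]> + W)%VS -> exists c, exists2 v', v' \in W & v = c *: w + v'.
Proof. by case/memv_addP=> _ /vlineP[c ->] [v' Wv' ->]; exists c, v'. Qed.

Section AlgebraPowers.

Variables (F : finFieldType) (A : vectType F) (mul : A -> A -> A).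
Hypothesis mulP : is_pre_lie mul.

Local Notation P := (algpow mul).

Implicit Types (U V W : {vspace A}) (u v : A).

Let pmulE := (pmulDl mulP, pmulDr mulP, pmulZl mulP, pmulZr mulP).

Lemma algpow_mem i n v : (i <= n)%N -> product_of mul n v -> v \in P i.
Proof.
move=> le_in nv; apply: memv_span; rewrite mem_filter; apply/andP; split.
  by apply/asboolP; exists n.
exact: (mem_enum (finvect_type A) v).
Qed.

Lemma algpow_subP i W :
  (forall n v, (i <= n)%N -> product_of mul n v -> v \in W) -> (P i <= W)%VS.
Proof.
move=> PW; apply/span_subvP=> v; rewrite mem_filter => /andP[/asboolP[n le_in nv] _].
exact: PW nv.
Qed.

Lemma algpow1 : P 1 = fullv.
Proof.
apply/eqP; rewrite eqEsubv subvf; apply/subvP=> v _.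
by apply: (@algpow_mem 1 1) => //; exists (Letter v).
Qed.

Lemma algpow_le i j : (i <= j)%N -> (P j <= P i)%VS.
Proof.
move=> le_ij; apply: algpow_subP => n v le_jn; apply: algpow_mem.
exact: leq_trans le_ij le_jn.
Qed.

Lemma algpow0 : P 0 = fullv.
Proof. by apply/eqP; rewrite eqEsubv subvf -algpow1 algpow_le. Qed.

Lemma algpowM i j u v : u \in P i -> v \in P j -> mul u v \in P (i + j)%N.
Proof.
move=> Pu Pv; move: u Pu; apply: (@span_ind _ _ (fun u => mul u v \in P (i + j)%N)).
- by rewrite pmul0l // mem0v.
- by move=> u u' Pu Pu'; rewrite pmulE rpredD.
- by move=> c u Pu; rewrite pmulE rpredZ.
move=> u; rewrite mem_filter => /andP[/asboolP[n le_in [t [size_t ->]]] _].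
move: v Pv; apply: (@span_ind _ _ (fun v => mul (evalb mul id t) v \in P (i + j)%N)).
- by rewrite pmul0r // mem0v.
- by move=> w w' Pw Pw'; rewrite pmulE rpredD.
- by move=> c w Pw; rewrite pmulE rpredZ.
move=> w; rewrite mem_filter => /andP[/asboolP[m le_jm [t' [size_t' ->]]] _].
apply: (@algpow_mem _ (n + m)); first exact: leq_add.
by exists (Prod t t'); rewrite /= size_t size_t'.
Qed.

Lemma algpowMW k i j u v : (k <= i + j)%N -> u \in P i -> v \in P j -> mul u v \in P k.
Proof. by move=> le_k Pu Pv; apply: (subvP (algpow_le le_k)); apply: algpowM. Qed.

Lemma evalb_algpow (T : Type) (f : T -> A) (t : bracketing T) :
  evalb mul f t \in P (nletters t).
Proof.
elim: t => [a|u IHu v IHv] /=; first by rewrite algpow1 memvf.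
exact: algpowM.
Qed.

Lemma algpow_split i W : (1 < i)%N ->
  (forall j u v, (0 < j < i)%N -> u \in P j -> v \in P (i - j)%N -> mul u v \in W) ->
  (P i <= W)%VS.
Proof.
move=> i_gt1 PW; apply: algpow_subP => n _ le_in [t [size_t ->]].
case: t size_t => [a /= n1|l r /= size_lr].
  by rewrite -n1 leqNgt i_gt1 in le_in.
have nletters_gt0 (t : bracketing A) : (0 < nletters t)%N.
  by elim: t => //= l' IHl r' _; rewrite addn_gt0 IHl.
(* The left factor alone may have i letters or more. *)
pose j := minn (nletters l) i.-1; apply: (PW j).
- rewrite leq_min nletters_gt0 ltn_predRL i_gt1 /=.
  by rewrite (leq_ltn_trans (geq_minr _ _)) // ltn_predL ltnW.
- by apply: (subvP (algpow_le (geq_minl _ _))); apply: evalb_algpow.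
apply: (subvP (algpow_le _)) (evalb_algpow id r).
rewrite leq_subLR /j; case: (leqP (nletters l) i.-1) => [le_l|lt_l].
  by rewrite (leq_trans le_in) // -size_lr.
by rewrite -(ltn_predK i_gt1) /= -addn1 leq_add2l.
Qed.

Lemma algpow_vanish i : (forall n, (i <= n)%N -> products_vanish mul n) -> P i = 0%VS.
Proof.
move=> vanish; apply/eqP; rewrite -subv0; apply: algpow_subP => n v le_in /(vanish n le_in) ->.
exact: mem0v.
Qed.

Lemma algpow0_vanish i n : P i = 0%VS -> (i <= n)%N -> products_vanish mul n.
Proof. by move=> Pi0 le_in v /(algpow_mem le_in); rewrite Pi0 memv0 => /eqP. Qed.

End AlgebraPowers.

(** * Pre-Lie algebras of dimension 4 with one generator *)

Lemma dim_line_add (F : fieldType) (A : vectType F) (w : A) (W : {vspace A}) :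
  (\dim (<[w]> + W) <= (\dim W).+1)%N.
Proof.
apply: leq_trans (dimv_add_leqif _ _) _; rewrite dim_vline -add1n leq_add2r.
exact: leq_b1.
Qed.

Lemma mem_line_add (F : fieldType) (A : vectType F) (w : A) (W : {vspace A}) c v :
  v \in W -> c *: w + v \in (<[w]> + W)%VS.
Proof. by move=> Wv; rewrite memv_add // memvZ // memv_line. Qed.

Lemma nletters_gt0 (T : Type) (t : bracketing T) : (0 < nletters t)%N.
Proof. by elim: t => //= l IHl r _; rewrite addn_gt0 IHl. Qed.

Lemma evalb_product_of (T A : Type) (mul : A -> A -> A) (f : T -> A) (t : bracketing T) :
  product_of mul (nletters t) (evalb mul f t).
Proof.
elim: t => [a|l [l' [size_l El]] r [r' [size_r Er]]]; first by exists (Letter (f a)).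
by exists (Prod l' r'); rewrite /= size_l size_r El Er.
Qed.

Lemma nletters1 (t : bracketing unit) : nletters t = 1%N -> t = Letter tt.
Proof.
case: t => [[] //|l r] /=; have := nletters_gt0 l; have := nletters_gt0 r; lia.
Qed.

Lemma nletters2 (t : bracketing unit) :
  nletters t = 2%N -> t = Prod (Letter tt) (Letter tt).
Proof.
case: t => [//|l r] /= size_lr; have l_gt0 := nletters_gt0 l.
have r_gt0 := nletters_gt0 r.
have l1 : nletters l = 1%N by lia.
have r1 : nletters r = 1%N by lia.
by rewrite (nletters1 l1) (nletters1 r1).
Qed.

Lemma nletters3 (t : bracketing unit) : let X := Letter tt in
  nletters t = 3%N -> t = Prod X (Prod X X) \/ t = Prod (Prod X X) X.
Proof.
case: t => [//|l r] /= size_lr; have l_gt0 := nletters_gt0 l.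
have r_gt0 := nletters_gt0 r.
have [[l1 r2]|[l2 r1]] : nletters l = 1%N /\ nletters r = 2%N
  \/ nletters l = 2%N /\ nletters r = 1%N by lia.
- by left; rewrite (nletters1 l1) (nletters2 r2).
- by right; rewrite (nletters2 l2) (nletters1 r1).
Qed.

Variant sum5_spec (m n : nat) : Prop :=
  | Sum5_left of (4 <= m)%N
  | Sum5_right of (4 <= n)%N
  | Sum5_32 of (3 <= m)%N & (2 <= n)%N
  | Sum5_23 of m = 2%N & n = 3%N.

Lemma nletters_sum5 m n : (m + n)%N = 5%N -> sum5_spec m n.
Proof.
case: m => [|[|[|[|m]]]] mn5; last by apply: Sum5_left.
- by apply: Sum5_right; lia.
- by apply: Sum5_right; lia.
- by apply: Sum5_23; lia.
- by apply: Sum5_32; lia.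
Qed.

(** The position of a bracketing in the list x, xx, (xx)x, x(xx); the bracketings of
    four letters or more get 4, which is beyond the end of the list. *)
Definition cubic_index (t : bracketing unit) : nat :=
  match t with
  | Letter _ => 0
  | Prod (Letter _) (Letter _) => 1
  | Prod (Prod (Letter _) (Letter _)) (Letter _) => 2
  | Prod (Letter _) (Prod (Letter _) (Letter _)) => 3
  | _ => 4
  end.

Lemma evalb_cubic (A : zmodType) (mul : A -> A -> A) (y : A) (t : bracketing unit) :
  (forall n, (3 < n)%N -> products_vanish mul n) ->
  evalb mul (fun=> y) t
    = [:: y; mul y y; mul (mul y y) y; mul y (mul y y)]`_(cubic_index t).
Proof.
move=> vanish; have [lt4|le4] := ltnP (cubic_index t) 4.
  by case: t lt4 => [//|[a|[a|l1 l2] [b|l3 l4]] [c|[c|r1 r2] [d|r3 r4]]].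
rewrite nth_default //; apply: (vanish (nletters t)); last exact: evalb_product_of.
have gt0 := @nletters_gt0 unit.
have pair_gt2 (l r : bracketing unit) :
    (if (l, r) is (Letter _, Letter _) then false else true) ->
    (2 < nletters l + nletters r)%N.
  have := gt0 l; have := gt0 r.
  case: l => [a|l1 l2]; case: r => [b|r1 r2] //= _ _ _.
  - have := gt0 r1; have := gt0 r2; lia.
  - have := gt0 l1; have := gt0 l2; lia.
  - have := gt0 l1; have := gt0 l2; have := gt0 r1; lia.
case: t le4 => [//|[a|l1 l2] [b|r1 r2]] //= le4.
- by apply: pair_gt2; case: r1 le4 => [?|? ?] //; case: r2.
- by rewrite addn1; apply: pair_gt2; case: l1 le4 => [?|? ?] //; case: l2.
have := gt0 l1; have := gt0 l2; have := gt0 r1; have := gt0 r2; lia.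
Qed.

Lemma sum_cubic (F : fieldType) (V : lmodType F) (r : seq (F * bracketing unit))
    (B : seq V) : size B = 4%N ->
  \sum_(c <- r) c.1 *: B`_(cubic_index c.2)
    = \sum_(j < 4) (\sum_(c <- r | cubic_index c.2 == j) c.1) *: B`_j.
Proof.
move=> size_B; transitivity
    (\sum_(c <- r) \sum_(j < 4 | cubic_index c.2 == j) c.1 *: B`_j).
  apply: eq_bigr => c _; have [lt4|le4] := ltnP (cubic_index c.2) 4.
    by rewrite (big_pred1 (Ordinal lt4)) // => j; rewrite -val_eqE eq_sym.
  rewrite nth_default ?size_B // scaler0 big_pred0 // => j.
  by rewrite gtn_eqF // (leq_trans (ltn_ord j)).
rewrite (exchange_big_dep xpredT) //=.
by apply: eq_bigr => j _; rewrite scaler_suml.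
Qed.

Section OneGenerator.

Variables (F : finFieldType) (A : vectType F) (mul : A -> A -> A) (x : A).
Hypothesis mulP : is_pre_lie mul.
Hypothesis gen_x : pre_lie_generated mul x.
Variable m : nat.
Hypothesis Pm0 : algpow mul m = 0%VS.

Local Notation P := (algpow mul).
Local Notation "a · b" := (mul a b) (at level 40, left associativity).
Local Notation x2 := (x · x).
Local Notation u1 := (x · x2).
Local Notation u2 := (x2 · x).

Implicit Types (U V W : {vspace A}) (u v : A).

Let PM := algpowMW mulP.
Let Ple := algpow_le mul.

Let Px : x \in P 1. Proof. by rewrite algpow1 memvf. Qed.
Let Px2 : x2 \in P 2. Proof. exact: PM Px Px. Qed.
Let Pu1 : u1 \in P 3. Proof. exact: PM Px Px2. Qed.
Let Pu2 : u2 \in P 3. Proof. exact: PM Px2 Px. Qed.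

Lemma mul_expand c d y z u v :
  (c *: y + u) · (d *: z + v)
    = (c * d) *: (y · z) + (c *: (y · v) + (d *: (u · z) + u · v)).
Proof.
rewrite (pmulDl mulP) !(pmulDr mulP) !(pmulZl mulP) !(pmulZr mulP) scalerA.
by rewrite !addrA.
Qed.

(** The leading term of a product: the other terms lie in higher powers. *)
Lemma mul_lead i j k c d y z u v : (k <= i.+1 + j)%N -> (k <= i + j.+1)%N ->
  y \in P i -> z \in P j -> u \in P i.+1 -> v \in P j.+1 ->
  exists2 w, w \in P k & (c *: y + u) · (d *: z + v) = (c * d) *: (y · z) + w.
Proof.
move=> le1 le2 Py Pz Pu Pv.
exists (c *: (y · v) + (d *: (u · z) + u · v)); last exact: mul_expand.
rewrite !rpredD ?rpredZ //; [exact: PM Py Pv | exact: PM Pu Pz | apply: PM Pu Pv].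
by rewrite (leq_trans le1) // leq_add2l.
Qed.

Lemma algpow1_span : P 1 = (<[x]> + P 2)%VS.
Proof.
rewrite algpow1; apply/esym/gen_x; last first.
  by apply: (subvP (addvSl _ _)); apply: memv_line.
move=> u v _ _; apply: (subvP (addvSr _ _)).
by apply: (@PM 2 1 1) => //; rewrite algpow1 memvf.
Qed.

Lemma algpow1P v : exists c, exists2 v', v' \in P 2 & v = c *: x + v'.
Proof. by apply: memv_line_add; rewrite -algpow1_span algpow1 memvf. Qed.

Lemma algpow2_span : (P 2 <= <[x2]> + P 3)%VS.
Proof.
apply: algpow_split => // -[|[|j]] // u v _ Pu Pv.
have [c [u' Pu' ->]] := algpow1P u; have [d [v' Pv' ->]] := algpow1P v.
have [w Pw ->] := @mul_lead 1 1 3 c d _ _ _ _ isT isT Px Px Pu' Pv'.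
exact: mem_line_add.
Qed.

Lemma algpow2P v : v \in P 2 -> exists c, exists2 v', v' \in P 3 & v = c *: x2 + v'.
Proof. by move/(subvP algpow2_span)/memv_line_add. Qed.

Lemma algpow3_span : (P 3 <= <[u1]> + (<[u2]> + P 4))%VS.
Proof.
apply: algpow_split => // -[|[|[|j]]] // u v _ Pu Pv.
  have [c [u' Pu' ->]] := algpow1P u; have [d [v' Pv' ->]] := algpow2P Pv.
  have [w Pw ->] := @mul_lead 1 2 4 c d _ _ _ _ isT isT Px Px2 Pu' Pv'.
  exact/mem_line_add/(subvP (addvSr _ _)).
have [c [u' Pu' ->]] := algpow2P Pu; have [d [v' Pv' ->]] := algpow1P v.
have [w Pw ->] := @mul_lead 2 1 4 c d _ _ _ _ isT isT Px2 Px Pu' Pv'.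
exact/(subvP (addvSr _ _))/mem_line_add.
Qed.

(** This is the pre-Lie identity for x, x^2, x. *)
Lemma mul_x2_x2 : x2 · x2 = u2 · x - u1 · x + x · u2.
Proof.
have := pre_lie_law mulP x x2 x.
move: (u1 · x) (x · u2) (u2 · x) (x2 · x2) => a b c d abcd.
by rewrite -[LHS](subKr c) -abcd opprB addrA addrAC.
Qed.

(** If P i is contained in P j for all j, it is contained in P m = 0. This shows below
    that P i = P (i + 1) is possible for i < 4 only if P i = 0. *)
Lemma algpow_stationary i : (forall j, (i <= j)%N -> (P i <= P j)%VS -> (P i <= P j.+1)%VS) ->
  P i = 0%VS.
Proof.
move=> P_step; apply/eqP; rewrite -subv0 -Pm0.
have [le_im|lt_mi] := leqP i m; last exact: Ple (ltnW lt_mi).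
rewrite -(subnK le_im) addnC; elim: (m - i)%N => [|j IHj]; first by rewrite addn0.
by rewrite addnS; apply: P_step => //; apply: leq_addr.
Qed.

Lemma algpow1_stationary : (P 1 <= P 2)%VS -> P 1 = 0%VS.
Proof.
move=> sP; apply: algpow_stationary => j _ /subvP sPj.
apply: subv_trans sP _; apply: algpow_split => // -[|[|k]] // u v _ Pu Pv.
by apply: (@PM _ 1 j) => //; apply: sPj.
Qed.

Lemma algpow2_stationary : (P 2 <= P 3)%VS -> P 2 = 0%VS.
Proof.
move=> sP; apply: algpow_stationary => j le_2j /subvP sPj.
apply: subv_trans sP _; apply: algpow_split => // -[|[|[|k]]] // u v _ Pu Pv.
  by apply: (@PM _ 1 j) => //; apply: sPj.
by apply: (@PM _ j 1) => //; [rewrite addn1 | apply: sPj].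
Qed.

(** Of the products that span P 4, those of two elements of P 2 have no factor in P 3;
    but x^2 x^2 is a combination of products of x with elements of P 3. *)
Lemma algpow3_stationary : (P 3 <= P 4)%VS -> P 3 = 0%VS.
Proof.
move=> sP; apply: algpow_stationary => j le_3j /subvP sPj.
apply: subv_trans sP _; apply: algpow_split => // -[|[|[|[|k]]]] // u v _ Pu Pv.
- by apply: (@PM _ 1 j) => //; apply: sPj.
- have [c [u' Pu' ->]] := algpow2P Pu; have [d [v' Pv' ->]] := algpow2P Pv.
  have Pj1 u0 : u0 \in P 3 -> u0 · x \in P j.+1.
    by move=> Pu0; apply: (@PM _ j 1); rewrite ?addn1 ?sPj.
  have xPj u0 : u0 \in P 3 -> x · u0 \in P j.+1.
    by move=> Pu0; apply: (@PM _ 1 j); rewrite ?sPj.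
  have P2j : x2 · v' \in P j.+1 by apply: (@PM _ 2 j); rewrite ?sPj // ltnW.
  have Pj2 : u' · x2 \in P j.+1 by apply: (@PM _ j 2); rewrite ?sPj // addn2 ltnW.
  have Pj3 : u' · v' \in P j.+1.
    by apply: (@PM _ j 3); rewrite ?sPj // addn3 ltnW // ltnW.
  rewrite mul_expand mul_x2_x2; apply: memvD.
    by apply/memvZ/memvD; [apply: memvB; apply: Pj1 | apply: xPj].
  by apply: memvD; [apply: memvZ | apply: memvD; first apply: memvZ].
- by apply: (@PM _ j 1) => //; [rewrite addn1 | apply: sPj].
Qed.

Hypothesis dimA : \dim {:A} = 4%N.

Lemma algpow_lt i : (P i <= P i.+1)%VS = false -> (\dim (P i.+1) < \dim (P i))%N.
Proof. by move=> nsP; rewrite (ltn_leqif (dimv_leqif_sup (Ple (leqnSn i)))) nsP. Qed.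

Lemma dim_algpow2 : \dim (P 2) = 3%N.
Proof.
apply/eqP; rewrite eqn_leq -(ltnS _ 3) -(ltnS 3); apply/andP; split.
  rewrite -dimA -(algpow1 mul) algpow_lt //.
  by apply: contra_eqF dimA => /algpow1_stationary; rewrite algpow1 => ->; rewrite dimv0.
by rewrite -dimA -(algpow1 mul) algpow1_span dim_line_add.
Qed.

Lemma dim_algpow3 : \dim (P 3) = 2%N.
Proof.
apply/eqP; rewrite eqn_leq -(ltnS _ 2) -(ltnS 2); apply/andP; split.
  rewrite -[X in (_ < X)%N]dim_algpow2 algpow_lt //.
  by apply: contra_eqF dim_algpow2 => /algpow2_stationary ->; rewrite dimv0.
rewrite -[X in (X <= _)%N]dim_algpow2 (leq_trans (dimvS algpow2_span)) //.
exact: dim_line_add.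
Qed.

Lemma algpow3_nsub4 : (P 3 <= P 4)%VS = false.
Proof. by apply: contra_eqF dim_algpow3 => /algpow3_stationary ->; rewrite dimv0. Qed.

Lemma dim_algpow4 : (\dim (P 4) <= 1)%N.
Proof. by rewrite -ltnS -[X in (_ < X)%N]dim_algpow3 algpow_lt // algpow3_nsub4. Qed.

Lemma basis4 a b c d : (fullv <= <<[:: a; b; c; d]>>)%VS -> basis_of {:A} [:: a; b; c; d].
Proof. by move=> full; rewrite basisEdim full dimA. Qed.

Lemma span4_full c d : (P 3 <= <<[:: c; d]>>)%VS -> (fullv <= <<[:: x; x2; c; d]>>)%VS.
Proof.
move=> sP3; rewrite -(algpow1 mul) algpow1_span span_cons addvS //.
by apply: subv_trans algpow2_span _; rewrite span_cons addvS.
Qed.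

(** In every pre-Lie algebra without products of four elements, a bracketing of copies
    of y has the value of the entry of y, yy, (yy)y, y(yy) with the same index, or 0.
    These four are independent for y = x, so the coefficients of a relation add up to zero
    over the bracketings with a given index. *)
Lemma type_III_intro : P 4 = 0%VS -> type_III mul x.
Proof.
move=> P4_0; have vanish n : (3 < n)%N -> products_vanish mul n.
  exact: algpow0_vanish P4_0.
have basisX : basis_of {:A} [:: x; x2; u2; u1].
  apply/basis4/span4_full; apply: subv_trans algpow3_span _.
  by rewrite P4_0 addv0 span_cons span_seq1 addvC.
split=> // r sum0 C mC y mCP vanishC.
have sumE (V : lmodType F) (mV : V -> V -> V) z :
    (forall n, (3 < n)%N -> products_vanish mV n) ->
    \sum_(c <- r) c.1 *: evalb mV (fun=> z) c.2
      = \sum_(j < 4) (\sum_(c <- r | cubic_index c.2 == j) c.1)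
          *: [:: z; mV z z; mV (mV z z) z; mV z (mV z z)]`_j.
  move=> vanishV; rewrite -sum_cubic //; apply: eq_bigr => c _.
  by rewrite evalb_cubic.
have /freeP coef0 := basis_free basisX : free (in_tuple [:: x; x2; u2; u1]).
rewrite sumE //; apply: big1 => j _.
have -> := coef0 (fun j => \sum_(c <- r | cubic_index c.2 == j) c.1) _ j.
  by rewrite scale0r.
by rewrite -[RHS]sum0 sumE.
Qed.

Lemma algpow3_gens : (u1 \in P 4) && (u2 \in P 4) = false.
Proof.
apply/negP => /andP[P4u1 P4u2]; move/negP: algpow3_nsub4; apply.
apply: subv_trans algpow3_span _.
by rewrite !subv_add -!memvE P4u1 P4u2 subvv.
Qed.

Lemma algpow3_line a : P 4 != 0%VS -> a \in P 3 -> a \notin P 4 ->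
  P 3 = (<[a]> + P 4)%VS.
Proof.
rewrite -dimv_eq0 -lt0n => P4_gt0 Pa nPa; apply/esym/eqP.
rewrite eqEdim subv_add -memvE Pa Ple //= dim_algpow3.
apply: leq_ltn_trans P4_gt0 _.
by rewrite (ltn_leqif (dimv_leqif_sup (addvSr _ _))) subv_add -memvE (negPf nPa).
Qed.

Lemma algpow4_line b : b != 0 -> b \in P 4 -> P 4 = <[b]>%VS.
Proof.
move=> b_neq0 Pb; apply/esym/eqP; rewrite eqEdim -memvE Pb dim_vline b_neq0.
exact: dim_algpow4.
Qed.

Lemma dim_quotient i : \dim (P i :\: P i.+1) = (\dim (P i) - \dim (P i.+1))%N.
Proof.
rewrite -(dimv_cap_compl (P i) (P i.+1)) (capv_idPr _) ?addKn //.
exact: Ple (leqnSn i).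
Qed.

Lemma algpow_adapted a b i : P 5 = 0%VS -> P 3 = (<[a]> + P 4)%VS -> P 4 = <[b]>%VS ->
  P i = <<[seq e <- [:: x; x2; a; b] | e \in P i]>>%VS.
Proof.
move=> P5_0 defP3 defP4; set s := [:: x; x2; a; b].
apply/eqP; rewrite eqEsubv andbC; apply/andP; split.
  by apply/span_subvP=> e; rewrite mem_filter => /andP[].
have sub e : e \in s -> e \in P i -> (<[e]> <= <<[seq e <- s | e \in P i]>>)%VS.
  by move=> s_e Pe; rewrite -memvE memv_span // mem_filter Pe.
have Pb : b \in P 4 by rewrite defP4 memv_line.
have Pa : a \in P 3 by rewrite defP3 (subvP (addvSl _ _)) ?memv_line.
case: i sub => [|[|[|[|[|i]]]]] sub; 
  last by apply: subv_trans (Ple (leq_addr i 5)) _; rewrite P5_0 sub0v.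
- have -> : [seq e <- s | e \in P 0] = s.
    by apply/all_filterP/allP=> e _; rewrite algpow0 memvf.
  apply: subv_trans (subvf _) _; apply: span4_full; rewrite defP3 defP4.
  by rewrite span_cons span_seq1.
- have -> : [seq e <- s | e \in P 1] = s.
    by apply/all_filterP/allP=> e _; rewrite algpow1 memvf.
  apply: subv_trans (subvf _) _; apply: span4_full; rewrite defP3 defP4.
  by rewrite span_cons span_seq1.
- apply: subv_trans algpow2_span _; rewrite defP3 defP4 !subv_add.
  by rewrite !sub ?mem_head ?inE ?eqxx ?orbT // ?(subvP (Ple _) _ Pb) // (subvP (Ple _) _ Pa).
- by rewrite {1}defP3 defP4 subv_add !sub ?inE ?eqxx ?orbT // (subvP (Ple _) _ Pb).
- by rewrite {1}defP4 sub ?inE ?eqxx ?orbT.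
Qed.

Lemma type_II_intro : P 4 != 0%VS -> P 5 = 0%VS -> type_II mul x.
Proof.
move=> P4_neq0 P5_0; pose b := vpick (P 4).
have Pb : b \in P 4 by apply: memv_pick.
have b_neq0 : b != 0 by rewrite vpick0.
have defP4 := algpow4_line b_neq0 Pb.
have dimP4 : \dim (P 4) = 1%N by rewrite defP4 dim_vline b_neq0.
have P5_eq0 v : v \in P 5 -> v = 0 by rewrite P5_0 memv0 => /eqP.
have adapted a : a = u1 \/ a = u2 -> a \notin P 4 -> exists a b : A,
    [/\ a = x · x2 \/ a = x2 · x, b != 0 /\ b \in P 4, basis_of fullv [:: x; x2; a; b]
      & forall i, P i = <<[seq e <- [:: x; x2; a; b] | e \in P i]>>%VS].
  move=> a_u nPa; have Pa : a \in P 3 by case: a_u => ->.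
  have defP3 := algpow3_line P4_neq0 Pa nPa.
  exists a, b; split=> //; last by move=> i; apply: algpow_adapted.
  by apply/basis4/span4_full; rewrite defP3 defP4 span_cons span_seq1.
have relation al be : (al, be) <> (0, 0) -> al *: u1 + be *: u2 \in P 4 ->
    exists alpha beta : F, [/\ (alpha, beta) <> (0, 0),
      alpha *: u1 + beta *: u2 \in P 4,
      alpha *: (x · u1) + beta *: (x · u2) = 0
      & alpha *: (u1 · x) + beta *: (u2 · x) = 0].
  move=> ab_neq0 Pab; exists al, be; split=> //.
    rewrite -(pmulZr mulP al x u1) -(pmulZr mulP be x u2) -(pmulDr mulP).
    by apply/P5_eq0; apply: PM Px Pab.
  rewrite -(pmulZl mulP al u1 x) -(pmulZl mulP be u2 x) -(pmulDl mulP).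
  by apply/P5_eq0; apply: PM Pab Px.
have law : u2 · x - u1 · x = x2 · x2 - x · u2.
  by rewrite mul_x2_x2 addrK.
have vanish n : (5 <= n)%N -> products_vanish mul n by apply: algpow0_vanish P5_0.
have dims : [/\ \dim (P 2 :\: P 3) = 1, \dim (P 3 :\: P 4) = 1 & \dim (P 4) = 1]%N.
  by rewrite !dim_quotient dimP4 dim_algpow3 dim_algpow2.
have [Pu1'|nPu1] := boolP (u1 \in P 4).
  have nPu2 : u2 \notin P 4 by move/negbT: algpow3_gens; rewrite Pu1'.
  split=> //; first by apply: (adapted u2) => //; right.
  apply: (relation 1 0); last by rewrite scale1r scale0r addr0.
  by case=> /eqP; rewrite oner_eq0.
split=> //; first by apply: (adapted u1) => //; left.
have [c [q Pq u2E]] : exists c, exists2 q, q \in P 4 & u2 = c *: u1 + q.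
  by apply: memv_line_add; rewrite -algpow3_line.
apply: (relation (- c) 1); first by case=> _ /eqP; rewrite oner_eq0.
by rewrite scale1r u2E addrA scaleNr addNr add0r.
Qed.

Section TypeI.

Hypothesis P5_neq0 : P 5 != 0%VS.

Let P4_dim1 : \dim (P 4) = 1%N.
Proof.
apply/eqP; rewrite eqn_leq dim_algpow4 lt0n dimv_eq0.
by apply: contra P5_neq0; rewrite -!subv0; apply: subv_trans (Ple _).
Qed.

Let P4_stable i : (4 <= i)%N -> P i != 0%VS -> P 4 = P i.
Proof.
move=> le_4i Pi_neq0; apply/esym/eqP; rewrite eqEdim Ple // P4_dim1 lt0n.
by rewrite dimv_eq0.
Qed.

Let P45 : P 4 = P 5. Proof. exact: P4_stable. Qed.

(** By the pre-Lie identity for x^2, x, u the difference is x^2 (x u) - x (x^2 u). *)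
Let mul_u2_mod u : u \in P 3 -> P 4 = P 6 -> u2 · u - u1 · u \in P 7.
Proof.
move=> Pu P46; have law := pre_lie_law mulP x2 x u.
have -> : u2 · u - u1 · u = x2 · (x · u) - x · (x2 · u).
  move: (u2 · u) (x2 · (x · u)) (u1 · u) (x · (x2 · u)) law => a b c d law.
  by rewrite -[a](subrK b) law addrAC [c - d]addrC addrK addrC.
apply: memvB.
  by apply: (@PM _ 2 6 _ _ _ Px2); rewrite -?P46 ?(PM _ Px Pu).
apply: (@PM _ 1 6 _ _ _ Px) => //; rewrite -P46 P45.
exact: PM Px2 Pu.
Qed.

(** If P 4 = P 5 = P 6, only the products of two elements of P 3 could be outside of
    P 7, and the pre-Lie identities for x^2, x, u and for u, x, x^2 with u in P 3 put
    them in P 7 as well. Then P 4 would be contained in all powers. *)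
Lemma algpow6_eq0 : P 6 = 0%VS.
Proof.
apply/eqP/negPn/negP => P6_neq0; have P46 := P4_stable (isT : 4 <= 6)%N P6_neq0.
have P4M k u v : (k <= 7)%N -> u \in P 4 -> v \in P 1 -> u · v \in P k.
  by move=> le_k7 Pu Pv; apply: (@PM _ 6 1) => //; rewrite -P46.
have PM4 k u v : (k <= 7)%N -> u \in P 1 -> v \in P 4 -> u · v \in P k.
  by move=> le_k7 Pu Pv; apply: (@PM _ 1 6) => //; rewrite -P46.
have P1 u : u \in P 1 by rewrite algpow1 memvf.
have Pu_u1 u : u \in P 3 -> u · u1 \in P 7.
  move=> Pu; have law := pre_lie_law mulP u x x2.
  have -> : u · u1 = (u · x) · x2 - (x · u) · x2 + x · (u · x2).
    move: (u · u1) ((u · x) · x2) ((x · u) · x2) (x · (u · x2)) law => a b c d law.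
    by rewrite -addrA [- c + d]addrC -opprB -law opprB addrC subrK.
  apply: memvD; first apply: memvB.
  - by apply: P4M => //; apply: PM Pu Px.
  - by apply: P4M => //; apply: PM Px Pu.
  - by apply: PM4 => //; rewrite P45; apply: PM Pu Px2.
have P33 u v : u \in P 3 -> v \in P 3 -> u · v \in P 7.
  move=> Pu Pv; have [Pu1'|nPu1] := boolP (u1 \in P 4).
    have nPu2 : u2 \notin P 4 by move/negbT: algpow3_gens; rewrite Pu1'.
    have := Pu; rewrite (algpow3_line _ Pu2 nPu2) => [/memv_line_add[c [q Pq ->]]|].
      rewrite (pmulDl mulP) (pmulZl mulP); apply: memvD; last exact: P4M.
      apply: memvZ; rewrite -[u2 · v](subrK (u1 · v)); apply: memvD.
        exact: mul_u2_mod.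
      exact: P4M.
    by rewrite P45.
  have := Pv; rewrite (algpow3_line _ Pu1 nPu1) => [/memv_line_add[c [q Pq ->]]|].
    rewrite (pmulDr mulP) (pmulZr mulP); apply: memvD; last exact: PM4.
    by apply: memvZ; apply: Pu_u1.
  by rewrite P45.
have sP67 : (P 6 <= P 7)%VS.
  apply: algpow_split => // -[|[|[|[|j]]]] // u v _ Pu Pv.
  - by apply: PM4 => //; apply: (subvP (Ple _)) Pv.
  - by apply: PM4.
  - exact: P33.
  - by apply: P4M => //; apply: (subvP (Ple _)) Pu.
move/negP: P5_neq0; apply; rewrite -P45; apply/eqP/algpow_stationary => j le_4j sPj.
rewrite {1}P46; apply: subv_trans sP67 _.
apply: algpow_split => // k u v /andP[k_gt0 lt_k7] Pu Pv.
have [le_4k|lt_k4] := leqP 4 k.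
  apply: (@PM _ j (7 - k)) => //; first by rewrite -addn1 leq_add2l subn_gt0.
  exact/(subvP sPj)/(subvP (Ple le_4k)).
apply: (@PM _ k j) => //; first by rewrite -add1n leq_add2r.
have le_47k : (4 <= 7 - k)%N := leq_sub2l 7 (lt_k4 : k <= 3)%N.
exact/(subvP sPj)/(subvP (Ple le_47k)).
Qed.

Let P5M u v : u \in P 4 -> u · v = 0.
Proof.
rewrite P45 => Pu; apply/eqP; rewrite -memv0 -algpow6_eq0.
by apply: (@PM _ 5 1) => //; rewrite algpow1 memvf.
Qed.

Let PM5 u v : v \in P 4 -> u · v = 0.
Proof.
rewrite P45 => Pv; apply/eqP; rewrite -memv0 -algpow6_eq0.
by apply: (@PM _ 1 5) => //; rewrite algpow1 memvf.
Qed.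

Let P6_0 v : v \in P 6 -> v = 0.
Proof. by rewrite algpow6_eq0 memv0 => /eqP. Qed.

(** This holds by the pre-Lie identity for u, x, x with u in P 3: the other terms have a
    factor in P 4 = P 5 and lie in P 6 = 0. *)
Let P32_eq0 u v : u \in P 3 -> v \in P 2 -> u · v = 0.
Proof.
move=> Pu /algpow2P[c [v' Pv' ->]].
rewrite (pmulDr mulP) (pmulZr mulP) [u · v']P6_0 ?addr0; last exact: PM Pu Pv'.
have := pre_lie_law mulP u x x.
rewrite (P5M (u := u · x) x) ?(P5M (u := x · u) x) ?(PM5 x (v := u · x));
  rewrite ?(PM _ Pu Px) ?(PM _ Px Pu) //.
by rewrite sub0r subr0 => /eqP; rewrite oppr_eq0 => /eqP ->; rewrite scaler0.
Qed.

(** Otherwise P 3 would be spanned by x x^2 modulo P 4, and P 5 by x^2 (x x^2), which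
    vanishes by the pre-Lie identity for x^2, x, x^2. *)
Let Pu1' : u1 \in P 4.
Proof.
apply/negPn/negP => nPu1; move/negP: P5_neq0; apply; rewrite -subv0.
have P4_neq0 : P 4 != 0%VS by rewrite P45.
apply: algpow_split => // -[|[|[|[|[|j]]]]] // u v _ Pu Pv; rewrite memv0.
- by rewrite PM5.
- have := Pv; rewrite (algpow3_line P4_neq0 Pu1 nPu1) => /memv_line_add[c [q Pq ->]].
  have [d [u' Pu' ->]] := algpow2P Pu.
  rewrite (pmulDr mulP) (pmulZr mulP) (PM5 _ Pq) addr0 (pmulDl mulP) (pmulZl mulP).
  rewrite [u' · u1]P6_0 ?addr0; last exact: PM Pu' Pu1.
  have := pre_lie_law mulP x2 x x2.
  rewrite (P32_eq0 Pu2 Px2) (P32_eq0 Pu1 Px2) (PM5 x (PM _ Px2 Px2)) //.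
  by rewrite subr0 sub0r => /eqP; rewrite oppr_eq0 => /eqP ->; rewrite !scaler0.
- by rewrite P32_eq0.
- by rewrite P5M.
Qed.

Let nPu2 : u2 \notin P 4. Proof. by move/negbT: algpow3_gens; rewrite Pu1'. Qed.

Let w := x2 · u2.

Let P4_line : P 4 = <[w]>%VS.
Proof.
have P4_neq0 : P 4 != 0%VS by rewrite P45.
have Pw : w \in P 4 by rewrite P45; apply: PM Px2 Pu2.
apply: algpow4_line => //; apply: contra P5_neq0 => /eqP w0; rewrite -subv0.
apply: algpow_split => // -[|[|[|[|[|j]]]]] // u v _ Pu Pv; rewrite memv0.
- by rewrite PM5.
- have := Pv; rewrite (algpow3_line P4_neq0 Pu2 nPu2) => /memv_line_add[c [q Pq ->]].
  have [d [u' Pu' ->]] := algpow2P Pu.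
  rewrite (pmulDr mulP) (pmulZr mulP) (PM5 _ Pq) addr0 (pmulDl mulP) (pmulZl mulP).
  by rewrite -/w w0 [u' · u2]P6_0 ?addr0 ?scaler0 //; apply: PM Pu' Pu2.
- by rewrite P32_eq0.
- by rewrite P5M.
Qed.

Lemma type_I_intro : type_I mul x.
Proof.
have Pw v : v \in P 4 -> exists al, v = al *: w by rewrite P4_line => /vlineP.
have w_neq0 : w != 0.
  by apply: contra P5_neq0 => /eqP w0; rewrite -P45 P4_line w0.
split.
- by split=> //; apply: algpow6_eq0.
- apply/basis4/span4_full; rewrite (algpow3_line _ Pu2 nPu2) ?P45 //.
  by rewrite -P45 P4_line span_cons span_seq1.
- split=> // t le5 neq_t; have Pt := evalb_algpow mulP (fun=> x) t.
  have [le6|] := leqP 6 (nletters t); first exact/P6_0/(subvP (Ple le6)).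
  rewrite ltnS leq_eqVlt ltnNge le5 orbF => /eqP size_t.
  case: t size_t neq_t {le5 Pt} => [//|l r] /= size_lr neq_t.
  have Pl := evalb_algpow mulP (fun=> x) l; have Pr := evalb_algpow mulP (fun=> x) r.
  rewrite /evalx /=; case: (nletters_sum5 size_lr) => [le4l|le4r|le3l le2r|l2 r3].
  + exact/P5M/(subvP (Ple le4l)).
  + exact/PM5/(subvP (Ple le4r)).
  + by apply: P32_eq0; [apply: (subvP (Ple le3l)) | apply: (subvP (Ple le2r))].
  rewrite (nletters2 l2) in neq_t *.
  by case: (nletters3 r3) neq_t => -> neq_t; [rewrite /= PM5 | case: neq_t].
- split; last by rewrite PM5.
    by rewrite mul_x2_x2 (P5M x Pu1') subr0.
  by rewrite P5M.
have [alpha u1E] := Pw _ Pu1'.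
have [beta u2xE] := Pw _ (@PM 4 3 1 _ _ isT Pu2 Px).
have [gamma xu2E] := Pw _ (@PM 4 1 3 _ _ isT Px Pu2).
by exists alpha, beta, gamma.
Qed.

End TypeI.

Lemma one_generator_types : [\/ type_I mul x, type_II mul x | type_III mul x].
Proof.
have [P4_0|P4_neq0] := eqVneq (P 4) 0%VS.
  by apply: Or33; apply: type_III_intro.
have [P5_0|P5_neq0] := eqVneq (P 5) 0%VS.
  by apply: Or32; apply: type_II_intro.
by apply: Or31; apply: type_I_intro.
Qed.

Lemma one_generator_vanish n : (6 <= n)%N -> products_vanish mul n.
Proof.
have P6_0 : P 6 = 0%VS.
  have [P5_0|P5_neq0] := eqVneq (P 5) 0%VS; last exact: algpow6_eq0.
  by apply/eqP; rewrite -subv0 -P5_0 Ple.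
exact: algpow0_vanish P6_0.
Qed.

End OneGenerator.

(** * Braces of order p^4 with one generator *)

Lemma sum_nat_trunc (V : zmodType) (f : nat -> V) (j m n : nat) :
  (forall i, (m <= i)%N -> f i = 0) -> (forall i, (n <= i)%N -> f i = 0) ->
  \sum_(j <= i < m) f i = \sum_(j <= i < n) f i.
Proof.
have trunc k l : (k <= l)%N -> (forall i, (k <= i)%N -> f i = 0) ->
    \sum_(j <= i < k) f i = \sum_(j <= i < l) f i.
  move=> le_kl f0; have [le_jk|lt_kj] := leqP j k.
    rewrite [RHS](big_cat_nat le_jk le_kl) /= [X in _ + X]big_nat_cond.
    by rewrite [X in _ + X]big1 ?addr0 // => i /andP[/andP[/f0 ->]].
  rewrite big_geq ?(ltnW lt_kj) // big_nat_cond big1 // => i /andP[/andP[le_ji _] _].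
  by rewrite f0 // (leq_trans (ltnW lt_kj)).
move=> f0m f0n; have [le_mn|lt_nm] := leqP m n; first exact: trunc.
by rewrite (trunc n m) // ltnW.
Qed.

Lemma products_vanish_iter (A : zmodType) (mul : A -> A -> A) (k i : nat) a b :
  products_vanish mul k.+1 -> (k <= i)%N -> iter i (mul a) b = 0.
Proof.
move=> vanish le_ki; rewrite -(subnKC le_ki) iterD; apply: vanish.
exists (iter k (Prod (Letter a)) (Letter (iter (i - k) (mul a) b))).
elim: k {le_ki} (iter _ _ b) => [//|k IHk] c /=.
by have [-> <-] := IHk c.
Qed.

Lemma foldr_nseq_iter (T R : Type) (f : T -> R -> R) a b i :
  foldr f b (nseq i a) = iter i (f a) b.
Proof. by elim: i => //= i ->. Qed.

(** The series of the group of flows may be cut off at any place from which its terms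
    vanish. *)
Lemma flow_series_cutoff (F : fieldType) (A : lmodType F) (mul : A -> A -> A) (d k : nat) :
  (forall s b, (d <= size s)%N -> foldr mul b s = 0) -> products_vanish mul k.+1 ->
  expL mul k.+1 =2 expL mul d.+1 /\ flowW mul k.+1 =1 flowW mul d.
Proof.
move=> fold0 vanish; have iter0 a b i : (d <= i)%N -> iter i (mul a) b = 0.
  by move=> le_di; rewrite -foldr_nseq_iter fold0 // size_nseq.
split=> [a b|a]; apply: sum_nat_trunc => i lt_i.
- by rewrite (products_vanish_iter a b vanish) ?scaler0 // ltnW.
- by rewrite iter0 ?scaler0 // ltnW.
- by rewrite (products_vanish_iter a a vanish) ?scaler0 // -ltnS prednK ltnW // (leq_trans _ lt_i).
- by rewrite iter0 ?scaler0 // -ltnS prednK // (leq_trans _ lt_i).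
Qed.

Lemma nilpotency_index_exists (A : zmodType) (mul : A -> A -> A) (n : nat) :
  products_vanish mul n.+1 ->
  exists k, nilpotency_index mul k.+1 /\ (k <= n)%N.
Proof.
move=> vanish; have ex_k : exists k, `[< products_vanish mul k.+1 >].
  by exists n; apply/asboolP.
case: (ex_minnP ex_k) => k /asboolP vanish_k min_k; exists k; split; last first.
  by apply: min_k; apply/asboolP.
split=> // -[//|m] /andP[_ lt_mk] /asboolP/min_k.
by rewrite leqNgt -ltnS lt_mk.
Qed.

Theorem corollary17 (p : nat) (p_prime : prime p) (p_gt : (2 ^ 6 < p)%N)
    (A : vectType 'F_p) (B : left_brace A)
    (FB : is_F_brace B)
    (cardA : #|finvect_type A| = (p ^ 4)%N)
    (rnilB : right_nilpotent B)
    (genB : exists x : A, brace_generated B x) :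
  exists mul : A -> A -> A,
    [/\ is_pre_lie mul,
        is_group_of_flows mul B
      & exists2 x : A, pre_lie_generated mul x
          & [\/ type_I mul x, type_II mul x | type_III mul x]].
Proof.
have dimA : dim A = 4%N.
  have := card_finvect p_prime A; rewrite cardA => /eqP.
  by rewrite eqn_exp2l ?prime_gt1 // => /eqP.
have d_gt0 : (0 < dim A)%N by rewrite dimA.
have n_small : (2 ^ (dim A).+1 <= p)%N.
  by rewrite dimA; apply: leq_trans (ltnW p_gt); rewrite leq_exp2l.
have [mul [Omega [mulP WK OmegaK flowB fold0]]] := brace_flows p_prime FB d_gt0 n_small.
have [r right0] : exists r, right_power mul r = 0%VS.
  have [r rnil] := rnilB; exists r; apply/eqP; rewrite -subv0; apply/subvP=> v Rv.
  have /rnil -> := right_power_sub_series p_prime FB d_gt0 n_small mulP WK flowB Rv.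
  exact: mem0v.
have left0 := left_power_foldr mulP fold0.
have Pm0 := algpow_vanish (products_vanish_big mulP left0 right0).
have [x genBx] := genB; exists mul.
have genx := brace_generated_pre_lie WK flowB genBx.
have dimA' : \dim {:A} = 4%N by rewrite dimvf.
split=> //; last by exists x => //; apply: one_generator_types Pm0 dimA'.
have vanish6 := one_generator_vanish mulP genx Pm0 dimA' (leqnn 6).
have [k [nil_k le_k5]] := nilpotency_index_exists vanish6.
exists k.+1.
  by split=> //; apply: leq_ltn_trans p_gt; apply: leq_trans (le_k5 : (k < 6)%N) _.
have [_ vanish_k _] := nil_k; have [expE WE] := flow_series_cutoff fold0 vanish_k.
exists Omega; split=> [a|a|a b]; first by rewrite WE.
  by rewrite WE.
by rewrite expE.
Qed.
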